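(* Let $X$ be a compact space of finite dimension, let $T\colon X\to X$ be a minimal homeomorphism, and let $\mathbb{E}$ be a real vector bundle over $X$. Let $\mathcal{R}$ be the set of all $A\in\mathrm{Aut}(\mathbb{E},T)$ such that, for every $T$-invariant Borel probability measure $\mu$ on $X$, the Oseledets splitting of $A$ with respect to $\mu$ coincides $\mu$-almost everywhere with the finest dominated splitting of $A$. Then the elements of $\mathcal{R}$ are exactly the automorphisms $A\in\mathrm{Aut}(\mathbb{E},T)$ such that, denoting by $\mathbb{E}_1\oplus\cdots\oplus\mathbb{E}_k$ the finest dominated splitting of $A$, each restriction $A|\mathbb{E}_i$ ($i=1,\dots,k$) is uniformly subexponentially quasiconformal.
   Context: Spaces are Hausdorff. $X$ has finite dimension if it is homeomorphic to a subset of some Euclidean space. $T$ is minimal if every orbit is dense. Vector bundles are real with fibers $\mathbb{E}(x)$ of constant finite dimension (and likewise for subbundles), and $\mathbb{E}$ is endowed with a Riemannian metric (a continuous choice of inner products on the fibers), which is restricted to subbundles. $\mathrm{Aut}(\mathbb{E},T)$ is the set of vector bundle automorphisms $A\colon\mathbb{E}\to\mathbb{E}$ covering $T$: the restriction of $A$ to each fiber $\mathbb{E}(x)$ is a linear isomorphism $A(x)\colon\mathbb{E}(x)\to\mathbb{E}(Tx)$. Write $A^n(x)=A(T^{n-1}x)\cdots A(x)$ for $n\ge 0$, and $A^{-n}(x)=(A^n(T^{-n}x))^{-1}$. Dominated splitting: an ordered splitting $\mathbb{E}=\mathbb{E}_1\oplus\cdots\oplus\mathbb{E}_k$ into nonzero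 subbundles is dominated for $A$ if it is $A$-invariant and there are constants $c>0$, $\tau>1$ such that for all $x\in X$, all unit vectors $v_1\in\mathbb{E}_1(x),\dots,v_k\in\mathbb{E}_k(x)$, all $1\le i<k$ and all $n\ge 0$, $\|A^n(x)v_i\|/\|A^n(x)v_{i+1}\|>c\tau^n$. The finest dominated splitting of $A$ is the unique dominated splitting with the maximal number $k$ of subbundles (it is trivial if $k=1$). Oseledets splitting: by the Oseledets theorem there is a set of points $x$, having full measure for every $T$-invariant probability, at which $\mathbb{E}(x)$ splits as a direct sum of nonzero subspaces $O_1(x)\oplus\cdots\oplus O_{k(x)}(x)$ with numbers $\lambda_1(x)>\cdots>\lambda_{k(x)}(x)$ such that $\lim_{n\to\pm\infty}\frac1n\log\|A^n(x)v\|=\lambda_j(x)$ for all nonzero $v\in O_j(x)$. It coincides at $x$ with the finest dominated splitting $\mathbb{E}_1\oplus\cdots\oplus\mathbb{E}_k$ if $k(x)=k$ and $O_j(x)=\mathbb{E}_j(x)$ for all $j$. For an isomorphism $L$ between inner product spaces, the quasiconformal distortion is $\kappa(L)=\log\big(\|L\|\,\|L^{-1}\|\big)$. An automorphism $B$ (of a vector bundle over $X$, covering $T$) is uniformly subexponentially quasiconformal if for every $\epsilon>0$ there exists $c_\epsilon>0$ such that $\kappa(B^n(x))\le c_\epsilon+\epsilon n$ for all $x\in X$ and $n\ge 0$. *)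

(* Defs.v *)
From HB Require Import structures.
From mathcomp Require Import all_boot all_order all_algebra.
From mathcomp Require Import all_classical all_reals all_analysis.

Set Implicit Arguments.
Unset Strict Implicit.
Unset Printing Implicit Defensive.

Import Order.TTheory GRing.Theory Num.Theory.
Import numFieldNormedType.Exports.

Local Open Scope classical_set_scope.
Local Open Scope ring_scope.

(* "Homeomorphic to a subset of R^n": f is injective and the topology of X is
   the one induced by f. *)
Definition finite_dimensional (R : realType) (X : topologicalType) :=
  exists (n : nat) (f : X -> 'rV[R]_n), injective f /\
    forall U : set X,
      open U <-> exists2 V : set 'rV[R]_n, open V & U = f @^-1` V.

Record homeo (X : topologicalType) := Homeo {
  homeo_fun :> X -> X;
  homeo_inv : X -> X;
  homeoK : cancel homeo_fun homeo_inv;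
  homeoVK : cancel homeo_inv homeo_fun;
  homeo_continuous : continuous homeo_fun;
  homeo_inv_continuous : continuous homeo_inv }.

Definition homeo_iter (X : topologicalType) (T : homeo X) (n : int) : X -> X :=
  match n with
  | Posz m => iter m T
  | Negz m => iter m.+1 (homeo_inv T)
  end.

Definition minimal (X : topologicalType) (T : homeo X) :=
  forall x : X, dense [set homeo_iter T n x | n in [set: int]].

Section Triviality.
Variables (R : realType) (X E : topologicalType) (F : X -> vectType R).
Variable inc : forall x, F x -> E.

Definition part (V : forall x, {vspace F x}) (U : set X) : set E :=
  [set e | exists x (v : F x), [/\ U x, v \in V x & e = inc v]].

(* (x, v) |-> (x, h (inc v)) is a homeomorphism from the part of V lying over
   U onto U x R^r, linear on each fiber, with inverse s. *)
Definition trivialization (V : forall x, {vspace F x}) (r : nat) (U : set X)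
    (h : E -> 'rV[R]_r) (s : X * 'rV[R]_r -> E) :=
  [/\ {within part V U, continuous h},
      {within U `*` [set: 'rV[R]_r], continuous s},
      forall x, U x -> forall (a : R) (v w : F x), v \in V x -> w \in V x ->
        h (inc (a *: v + w)) = a *: h (inc v) + h (inc w),
      forall x (v : F x), U x -> v \in V x -> s (x, h (inc v)) = inc v &
      forall x (c : 'rV[R]_r), U x ->
        h (s (x, c)) = c /\ exists2 v : F x, v \in V x & s (x, c) = inc v].

Definition locally_trivial (V : forall x, {vspace F x}) (r : nat) :=
  forall x0 : X, exists (U : set X) (h : E -> 'rV[R]_r) s,
    [/\ open U, U x0 & trivialization V U h s].

End Triviality.

(* The total space is a topological space whose points are exactly the pairs
   (x, v), v in fiber x, through the map inc. *)
Record vector_bundle (R : realType) (X : topologicalType) := VectorBundle {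
  fiber : X -> vectType R;
  total : topologicalType;
  proj : total -> X;
  inc : forall x, fiber x -> total;
  proj_inc : forall x (v : fiber x), proj (inc v) = x;
  inc_inj : forall x, injective (@inc x);
  inc_surj : forall e : total, exists v : fiber (proj e), inc v = e;
  proj_continuous : continuous proj;
  rank : nat;
  bundle_locally_trivial : locally_trivial inc (fun=> fullv) rank }.
Arguments inc {R X} v {x} _ : rename.
Arguments proj {R X v} _ : rename.

Section Bundles.
Variables (R : realType) (X : topologicalType).
Implicit Types (E : vector_bundle R X) (T : homeo X).

(* A subspace of the total space which is itself a vector bundle (of constant
   rank) for the induced topology and linear structures. *)
Definition subbundle E (V : forall x, {vspace fiber E x}) :=
  exists r : nat, locally_trivial (@inc R X E) V r.

(* A continuous real function on the fibered product of E with itself, which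
   is an inner product on each fiber; its values outside of the fibered
   product are irrelevant. *)
Record riemannian_metric E := RiemannianMetric {
  metric :> total E * total E -> R;
  metric_continuous :
    {within [set p | proj p.1 = proj p.2], continuous metric};
  metric_linear : forall x (w : fiber E x),
    scalar (fun v : fiber E x => metric (inc E v, inc E w));
  metric_sym : forall x (v w : fiber E x),
    metric (inc E v, inc E w) = metric (inc E w, inc E v);
  metric_gt0 : forall x (v : fiber E x),
    v != 0 -> 0 < metric (inc E v, inc E v) }.

Definition tnorm E (g : riemannian_metric E) (e : total E) : R :=
  Num.sqrt (g (e, e)).

Definition fnorm E (g : riemannian_metric E) (x : X) (v : fiber E x) : R :=
  tnorm g (inc E v).

(* aut_fib A x is the linear map A(x) : E(x) -> E(Tx) induced on the fibers by
   the homeomorphism A of the total space. *)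
Record aut E T := Aut {
  aut_homeo :> homeo (total E);
  aut_fib : forall x, 'Hom(fiber E x, fiber E (T x));
  aut_fib_bij : forall x, bijective (aut_fib x);
  autE : forall x (v : fiber E x),
    aut_homeo (inc E v) = inc E (aut_fib x v) }.

Fixpoint aut_pow E T (A : aut E T) (n : nat) (x : X) :
    'Hom(fiber E x, fiber E (iter n T x)) :=
  match n with
  | 0 => \1%VF
  | m.+1 => (aut_fib A (iter m T x) \o aut_pow A m x)%VF
  end.

(* A^n(x)v, n in Z, as a point of the total space, hence without casts between
   fibers; see aut_iter_pos and aut_iter_neg. *)
Definition aut_iter E T (A : aut E T) (n : int) (x : X) (v : fiber E x) :
  total E := homeo_iter A n (inc E v).

Lemma aut_iter_pos E T (A : aut E T) (n : nat) (x : X) (v : fiber E x) :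
  aut_iter A n%:Z v = inc E (aut_pow A n x v).
Proof.
rewrite /aut_iter /=; elim: n => [|n IHn] /=; first by rewrite id_lfunE.
by rewrite IHn autE comp_lfunE.
Qed.

Lemma aut_iter_neg E T (A : aut E T) (n : nat) (x : X) (v : fiber E x) :
  aut_iter A (- n%:Z) (aut_pow A n x v) = inc E v.
Proof.
rewrite /aut_iter; have -> e : homeo_iter A (- n%:Z) e = iter n (homeo_inv A) e by case: n.
rewrite -aut_iter_pos /aut_iter /=.
by elim: n => [|n IHn] //; rewrite iterSr [iter n.+1 A _]iterS homeoK.
Qed.

Section Dynamics.
Variables (E : vector_bundle R X) (g : riemannian_metric E) (T : homeo X).
Implicit Type A : aut E T.

Definition splitting (k : nat) (V : 'I_k -> forall x, {vspace fiber E x}) :=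
  [/\ forall i, subbundle (V i),
      forall i x, V i x != 0%VS &
      forall x, directv (\sum_(i < k) V i x)%VS /\
                (\sum_(i < k) V i x)%VS = fullv].

Definition invariant_splitting A (k : nat)
    (V : 'I_k -> forall x, {vspace fiber E x}) :=
  forall i x, (aut_fib A x @: V i x)%VS = V i (T x).

Definition dominated_splitting A (k : nat)
    (V : 'I_k -> forall x, {vspace fiber E x}) :=
  [/\ splitting V, invariant_splitting A V &
    exists c tau : R, [/\ 0 < c, 1 < tau &
      forall (x : X) (v : 'I_k -> fiber E x),
        (forall i, v i \in V i x /\ fnorm g (v i) = 1) ->
        forall i j : 'I_k, j = i.+1 :> nat -> forall n : nat,
        fnorm g (aut_pow A n x (v i)) / fnorm g (aut_pow A n x (v j))
          > c * tau ^+ n]].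

Definition finest_dominated_splitting A (k : nat)
    (V : 'I_k -> forall x, {vspace fiber E x}) :=
  dominated_splitting A V /\
  forall (k' : nat) (V' : 'I_k' -> forall x, {vspace fiber E x}),
    dominated_splitting A V' -> (k' <= k)%N.

(* O is the Oseledets splitting of E(x), with Lyapunov exponents lam; both are
   unique when they exist. *)
Definition oseledets_splitting A (x : X) (k : nat)
    (O : 'I_k -> {vspace fiber E x}) (lam : 'I_k -> R) :=
  [/\ forall j, O j != 0%VS,
      directv (\sum_(j < k) O j)%VS /\ (\sum_(j < k) O j)%VS = fullv,
      forall i j : 'I_k, (i < j)%N -> lam j < lam i &
      forall (j : 'I_k) (v : fiber E x), v \in O j -> v != 0 ->
        (fun n : nat => (n%:Z%:~R)^-1 * ln (tnorm g (aut_iter A n%:Z v)))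
          @ \oo --> lam j /\
        (fun n : nat =>
           ((- n%:Z)%:~R)^-1 * ln (tnorm g (aut_iter A (- n%:Z) v)))
          @ \oo --> lam j].

Definition oseledets_coincides A (k : nat)
    (V : 'I_k -> forall x, {vspace fiber E x}) (x : X) :=
  exists (O : 'I_k -> {vspace fiber E x}) (lam : 'I_k -> R),
    oseledets_splitting A O lam /\ forall j, O j = V j x.

(* Operator norm of the restriction of L to the subspace V. *)
Definition opnorm (x y : X) (V : {vspace fiber E x})
    (L : 'Hom(fiber E x, fiber E y)) : R :=
  sup [set fnorm g (L v) | v in [set v | v \in V /\ fnorm g v = 1]].

(* Distortion of the isomorphism L : V -> L(V), for L injective. *)
Definition qc_distortion (x y : X) (V : {vspace fiber E x})
    (L : 'Hom(fiber E x, fiber E y)) : R :=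
  ln (opnorm V L * opnorm (L @: V)%VS (L^-1)%VF).

(* For the restriction of A to an invariant subbundle V. *)
Definition unif_subexp_quasiconformal A (V : forall x, {vspace fiber E x}) :=
  forall eps : R, 0 < eps -> exists c : R, 0 < c /\
    forall (x : X) (n : nat),
      qc_distortion (V x) (aut_pow A n x) <= c + eps * n%:R.

End Dynamics.
End Bundles.

Definition borel (X : ptopologicalType) : measurableType _ :=
  g_sigma_algebraType (@open X).

Definition invariant_measure (R : realType) (X : ptopologicalType)
    (T : homeo X) (mu : probability (borel X) R) :=
  forall B : set (borel X), measurable B -> mu (T @^-1` B) = mu B.

Definition oseledets_is_finest_dominated (R : realType) (X : ptopologicalType)
    (E : vector_bundle R X) (g : riemannian_metric E) (T : homeo X) :
    set (aut E T) :=
  [set A | exists (k : nat) (V : 'I_k -> forall x, {vspace fiber E x}),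
    finest_dominated_splitting g A V /\
    forall mu : probability (borel X) R, invariant_measure T mu ->
      {ae mu, forall x : borel X, oseledets_coincides g A V x}].
Arguments oseledets_is_finest_dominated {R X E} g T.

(* Main.v *)
From HB Require Import structures.
Require Import Defs.
From mathcomp Require Import all_boot all_order all_algebra.
From mathcomp Require Import all_classical all_reals all_analysis.
From mathcomp Require Import finmap measurable_realfun.
From mathcomp Require Import ring lra zify.

Set Implicit Arguments.
Unset Strict Implicit.
Unset Printing Implicit Defensive.

Import Order.TTheory GRing.Theory Num.Theory.
Import numFieldNormedType.Exports.

Local Open Scope classical_set_scope.
Local Open Scope ring_scope.

(** Both sides of the equality speak of a finest dominated splitting, and they can
    use the same one. So it suffices to show, for one dominated splitting, that
    its summands are all uniformly subexponentially quasiconformal if and only if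
    it is the Oseledets splitting almost everywhere for every invariant measure.

    Along an invariant subbundle [V], let a(n, x) be the largest value of
    log(|A^n v| / |v|) for nonzero v in V(x), with n in Z ([max_growth]). This is a
    subadditive cocycle over T, bounded by a multiple of |n|, upper semicontinuous
    in x, and the quasiconformal distortion of A^n on V(x) is
    a(n, x) + a(-n, T^n x) ([qc_distortionE]). Both implications are statements
    about such a cocycle.

    Suppose that at almost every point all vectors of V have a common two-sided
    exponent. A finite basis of V(x) controls the operator norm, so a(n, x) / n and
    a(-n, x) / n tend to opposite limits ([max_growth_limit]), and their sum tends
    to 0 in the mean for every invariant measure. If the distortion were not
    uniformly subexponential, it would exceed eps * n along orbit segments of
    unbounded length n; since the distortion is subadditive too, a limit of the
    empirical measures along these segments would be an invariant measure for
    which the integral of a(N, .) + a(-N, .) is at least N * eps for every N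
    ([empirical_limit_measure], [uniform_distortion_of_regular]). The exponents of
    the past matter here: those of the future alone do not control the growth of
    the inverse of A^n at T^n x.

    Conversely, a subexponential distortion makes a(n, x) additive up to errors of
    small relative size, so the ergodic theorem, in the form that equates the
    limits of forward and backward averages ([birkhoff_two_sided]), yields
    exponents at almost every point ([regular_of_uniform_distortion]). The
    individual vectors of V(x) have the same exponents, because their growth
    differs from a(n, x) by at most the distortion ([growth_limit]), and domination
    makes the exponents of the successive summands strictly decreasing
    ([exponents_decreasing]). *)

(** * Bounded functions and the maximal inequality *)

Definition birkhoff_sum (R : realType) (X : Type) (S : X -> X) (f : X -> R)
  (n : nat) (x : X) : R := \sum_(i < n) f (iter i S x).

Lemma birkhoff_sumS (R : realType) (X : Type) (S : X -> X) (f : X -> R) n x :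
  birkhoff_sum S f n.+1 x = f x + birkhoff_sum S f n (S x).
Proof.
rewrite /birkhoff_sum big_ord_recl /=; congr (_ + _).
by apply: eq_bigr => i _; rewrite -iterS iterSr.
Qed.

Lemma birkhoff_sumSr (R : realType) (X : Type) (S : X -> X) (f : X -> R) n x :
  birkhoff_sum S f n.+1 x = birkhoff_sum S f n x + f (iter n S x).
Proof. by rewrite /birkhoff_sum big_ord_recr. Qed.

Section Maximal.
Context d (X : measurableType d) (R : realType) (mu : probability X R).
Variable S : X -> X.
Hypothesis mS : measurable_fun setT S.
Hypothesis invS : forall B, measurable B -> mu (S @^-1` B) = mu B.

Lemma bounded_integrable (D : set X) (f : X -> R) (C : R) : measurable D ->
  measurable_fun setT f -> (forall x, `|f x| <= C) ->
  mu.-integrable D (EFin \o f).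
Proof.
move=> mD mf fC; apply: measurable_bounded_integrable => //.
- by apply: le_lt_trans (probability_le1 mu mD) _; rewrite ltry.
- exact: measurable_funTS.
- by exists C; split; [exact: num_real|] => M CM x _; apply: le_trans (fC x) (ltW CM).
Qed.

Lemma bounded_convergence (D : set X) (f_ : nat -> X -> R) (f : X -> R)
    (C : R) : measurable D -> (forall n, measurable_fun setT (f_ n)) ->
  measurable_fun setT f -> (forall n x, `|f_ n x| <= C) ->
  {ae mu, forall x, D x -> f_ n x @[n --> \oo] --> f x} ->
  (\int[mu]_(x in D) (f_ n x)%:E)%E @[n --> \oo] -->
  (\int[mu]_(x in D) (f x)%:E)%E.
Proof.
move=> mD mf_ mf fC cvgf.
have [] // := @dominated_convergence _ X R mu D mD (fun n => EFin \o f_ n)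
   (EFin \o f) (cst C%:E).
- by move=> n; apply/measurable_EFinP; exact: measurable_funTS.
- by apply/measurable_EFinP; exact: measurable_funTS.
- apply: filterS cvgf => x + Dx => /(_ Dx) fx.
  by apply: cvg_EFin => //; exact: nearW.
- apply: (@bounded_integrable D (cst C) `|C|) => //; exact: measurable_cst.
- by apply: aeW => x n _; rewrite lee_fin.
Qed.

Lemma integral_invariant (D : set X) (f : X -> R) (C : R) : measurable D ->
  S @^-1` D = D -> measurable_fun setT f -> (forall x, `|f x| <= C) ->
  (\int[mu]_(x in D) (f (S x))%:E = \int[mu]_(x in D) (f x)%:E)%E.
Proof.
move=> mD SD mf fC.
have mfS : measurable_fun setT (f \o S) by exact: measurableT_comp.
have := @integral_pushforward _ _ X X R S mS mu D (EFin \o f) _ _ mD.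
rewrite SD => <- //.
- apply: eq_measure_integral => A mA _; exact: (invS mA).
- exact/measurable_EFinP.
- exact: (bounded_integrable mD mfS (fun x => fC (S x))).
Qed.

(** Garsia's argument: the running maxima [M N] of the Birkhoff sums of [g]
    satisfy [M N <= g + M N \o S] wherever they are positive, and [M N] and
    [M N \o S] have the same integral over the invariant set [D]. Hence [g] has
    a nonnegative integral over the part of [D] where [M N] is positive, and by
    hypothesis these parts exhaust [D]. *)
Lemma maximal_inequality (D : set X) (g : X -> R) (C : R) : measurable D ->
  S @^-1` D = D -> measurable_fun setT g -> (forall x, `|g x| <= C) ->
  (forall x, D x -> exists n, 0 < birkhoff_sum S g n x) ->
  (0 <= \int[mu]_(x in D) (g x)%:E)%E.
Proof.
move=> mD SD mg gC posD.
pose M N := iter N (fun (m : X -> R) x => Num.max 0 (g x + m (S x))) (fun=> 0).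
have M_ge0 N x : 0 <= M N x by case: N => [|N] //=; rewrite le_max lexx.
have cocycle_bound_ge0 : 0 <= C by apply: le_trans (gC point).
have M_leC N x : `|M N x| <= C *+ N.
  elim: N x => [|N IH] x; first by rewrite normr0.
  rewrite ger0_norm // /= ge_max mulrn_wge0 //= mulrS lerD //.
    exact: le_trans (ler_norm _) (gC _).
  exact: le_trans (ler_norm _) (IH _).
have mM N : measurable_fun setT (M N).
  elim: N => [|N IH]; first exact: measurable_cst.
  apply: measurable_maxr; first exact: measurable_cst.
  by apply: measurable_funD => //; exact: measurableT_comp.
have M_mono N x : M N x <= M N.+1 x.
  elim: N x => [|N IH] x; first exact: M_ge0.
  by rewrite /= ge_max le_max lexx /= le_max lerD2l IH orbT.
have M_sum N n x : (n <= N)%N -> birkhoff_sum S g n x <= M N x.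
  elim: N n x => [|N IH] [|n] x //.
  - by rewrite /birkhoff_sum big_ord0.
  - by rewrite /birkhoff_sum big_ord0.
  - by move=> nN; rewrite birkhoff_sumS /= le_max lerD2l IH ?orbT.
pose h N x := if 0 < M N x then g x else 0.
have hC N x : `|h N x| <= C by rewrite /h; case: ifP; rewrite ?normr0.
have mh N : measurable_fun setT (h N).
  by apply: measurable_fun_ifT => //; exact: measurable_fun_ltr.
have h_ge0 N : (0 <= \int[mu]_(x in D) (h N x)%:E)%E.
  have i1 := bounded_integrable mD (mh N) (hC N).
  have i2 := bounded_integrable mD (mM N) (M_leC N).
  have mMS : measurable_fun setT (M N \o S) by exact: measurableT_comp.
  have i3 : mu.-integrable D (EFin \o (M N \o S)).
    by apply: (@bounded_integrable D _ (C *+ N)) => // x; exact: M_leC.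
  have : (\int[mu]_(x in D) (M N x)%:E <=
          \int[mu]_(x in D) ((h N x)%:E + (M N (S x))%:E))%E.
    apply: le_integral => //; first exact: integrableD.
    move=> x _; rewrite lee_fin /h; case: ifPn => [Mpos|Mneg].
      have := M_mono N x; rewrite /= le_max => /orP[] //.
      by rewrite leNgt Mpos.
    by rewrite add0r (le_trans _ (M_ge0 _ _)) // leNgt.
  rewrite integralD // (integral_invariant mD SD (mM N) (M_leC N)).
  have : (\int[mu]_(x in D) (M N x)%:E \is a fin_num)%E by exact: integrable_fin_num.
  move: (\int[mu]_(x in D) (M N x)%:E)%E => I If.
  by rewrite -[leLHS]add0e leeD2rE.
have hg x : D x -> h N x @[N --> \oo] --> g x.
  move=> /posD[n bpos]; apply: cvg_near_cst; exists n => // N nN.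
  by rewrite /h (lt_le_trans bpos (M_sum _ _ _ nN)).
have cvgh := bounded_convergence mD mh mg hC (aeW _ hg).
rewrite -(cvg_lim _ cvgh) //.
by apply: lime_ge => //; [exact: cvgP cvgh | exact: nearW].
Qed.
End Maximal.

(** * The two-sided ergodic theorem *)

(** The strict inequality limsup u > b. The margin [j.+1%:R^-1] absorbs
    perturbations of [u] that vanish at infinity, and it expresses the condition
    by countable operations on conditions about single terms. *)
Definition limsup_gt (R : realType) (u : nat -> R) (b : R) :=
  exists j : nat, forall m, exists n, (m <= n)%N /\ b + j.+1%:R^-1 <= u n.

Lemma limsup_gtP (R : realType) (u : nat -> R) (b : R) :
  limsup_gt u b <-> exists2 b', b < b' & forall m, exists2 n, (m <= n)%N & b' <= u n.
Proof.
split=> [[j uj]|[b' bb' ub']].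
  exists (b + j.+1%:R^-1); first by rewrite ltrDl invr_gt0.
  by move=> m; have [n [mn un]] := uj m; exists n.
have [j jb] : exists j : nat, j.+1%:R^-1 < b' - b.
  have [] := @near_infty_natSinv_lt R (PosNum (_ : 0 < b' - b)%R).
    by rewrite subr_gt0.
  by move=> h j _ /(_ j (leqnn j)) /=; exists j.
exists j => m; have [n mn un] := ub' m; exists n; split => //.
by apply: le_trans un; rewrite -lerBrDl ltW.
Qed.

(** The inequality limsup u <= liminf v, through rational gaps: this form is a
    countable conjunction, hence compatible with almost everywhere statements. *)
Definition limsup_le_liminf (R : realType) (u v : nat -> R) :=
  forall a b : rat, a < b ->
    ~ (limsup_gt u (ratr b) /\ limsup_gt (fun n => - v n) (- ratr a)).

(** The inequality limsup u <= liminf u gives the convergence of [u], and the two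
    others squeeze [v]. The limit is the supremum of the [q] with limsup u > q. *)
Lemma cvg_same_limit (R : realType) (u v : nat -> R) (C : R) :
  (forall n, `|u n| <= C) ->
  limsup_le_liminf u v ->
  limsup_le_liminf u u ->
  limsup_le_liminf v u ->
  exists l : R, u @ \oo --> l /\ v @ \oo --> l.
Proof.
move=> uC uv uu vu.
have uCb n : - C <= u n <= C by rewrite -ler_norml.
pose A := [set q | limsup_gt u q].
have supA : has_sup A.
  split; first exists (- C - 1); first (apply/limsup_gtP; exists (- C)).
  - lra.
  - by move=> m; exists m => //; have /andP[] := uCb m.
  exists C => q /limsup_gtP[b' qb' /(_ 0)[n _ un]].
  by rewrite ltW // (lt_le_trans qb') // (le_trans un) //; have /andP[] := uCb n.
pose l := sup A.
have key (s t : nat -> R) (p q : R) : p < q ->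
   limsup_le_liminf s t ->
   limsup_gt s q -> \forall n \near \oo, p < t n.
  move=> pq st sq; have [a] := rat_in_itvoo pq; rewrite in_itv /= => /andP[pa aq].
  have [b] := rat_in_itvoo aq; rewrite in_itv /= ltr_rat => /andP[ab bq].
  apply: contrapT => nt; apply: (st _ _ ab); split; apply/limsup_gtP.
    move/limsup_gtP: sq => [q' qq' h]; exists q' => //; exact: lt_trans qq'.
  exists (- p); first by rewrite ltrN2.
  move=> m; apply: contrapT => hm; apply: nt; exists m => // n /= mn.
  rewrite ltNge; apply/negP => tnp; apply: hm; exists n => //; by rewrite lerN2.
have lt_up e : 0 < e -> limsup_gt u (l - e).
  move=> e0; have [q Aq lq] := sup_adherent e0 supA.
  move/limsup_gtP: Aq => [q' qq' h]; apply/limsup_gtP; exists q' => //.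
  exact: lt_trans lq qq'.
have not_up e : 0 < e -> ~ limsup_gt u (l + e).
  by move=> e0 /(ub_le_sup supA.2); rewrite -/l; lra.
have ev_lt (w : nat -> R) p q : p < q -> ~ limsup_gt w p -> \forall n \near \oo, w n < q.
  move=> pq nw; apply: contrapT => nt; apply: nw; apply/limsup_gtP; exists q => // m.
  apply: contrapT => hm; apply: nt; exists m => // n /= mn.
  by rewrite ltNge; apply/negP => tnp; apply: hm; exists n.
have low (t : nat -> R) : limsup_le_liminf u t ->
  forall e, 0 < e -> \forall n \near \oo, l - e < t n.
  move=> ut e e0; apply: (key u t _ (l - e / 2)) => //; first lra.
  by apply: lt_up; lra.
have upu e : 0 < e -> \forall n \near \oo, u n < l + e.
  by move=> e0; apply: (ev_lt _ (l + e/2)); [lra | apply: not_up; lra].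
have upv e : 0 < e -> \forall n \near \oo, v n < l + e.
  move=> e0; apply: (ev_lt v (l + e/2)); first lra.
  move=> vl.
  have e4 : 0 < e / 4 by lra.
  have h : \forall n \near \oo, l + e / 4 < u n.
    by apply: (key v u _ (l + e/2)) => //; lra.
  have [n [n1 n2]] := filter_ex (filterI h (upu _ e4)).
  by move: (lt_trans n1 n2); rewrite ltxx.
exists l; split; apply/cvgrPdist_lt => e e0; near=> n; rewrite ltr_distlC.
  apply/andP; split; near: n; [exact: low|exact: upu].
apply/andP; split; near: n; [exact: low|exact: upv].
Unshelve. all: by end_near.
Qed.

Section BirkhoffSums.
Variables (R : realType) (X : Type).
Implicit Types (S : X -> X) (f : X -> R).

Definition birkhoff_avg S f n x : R := birkhoff_sum S f n x / n%:R.

Lemma birkhoff_sumN S (f : X -> R) n x :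
  birkhoff_sum S (fun x => - f x) n x = - birkhoff_sum S f n x.
Proof. by rewrite /birkhoff_sum -sumrN. Qed.

Lemma birkhoff_avgN S (f : X -> R) n x :
  birkhoff_avg S (fun x => - f x) n x = - birkhoff_avg S f n x.
Proof. by rewrite /birkhoff_avg birkhoff_sumN mulNr. Qed.

Lemma birkhoff_sumB_cst S (f : X -> R) b n x :
  birkhoff_sum S (fun x => f x - b) n x = birkhoff_sum S f n x - b *+ n.
Proof.
by rewrite /birkhoff_sum big_split /= sumr_const card_ord mulNrn.
Qed.

Lemma birkhoff_sum_bound (S : X -> X) (f : X -> R) (C : R) n x :
  (forall x, `|f x| <= C) ->
  `|birkhoff_sum S f n x| <= C *+ n.
Proof.
move=> fC; apply: le_trans (ler_norm_sum _ _ _) _.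
rewrite -[n in _ *+ n]card_ord -sumr_const; exact: ler_sum.
Qed.

Lemma birkhoff_avg_bound (S : X -> X) (f : X -> R) (C : R) n x :
  (forall x, `|f x| <= C) ->
  `|birkhoff_avg S f n x| <= C.
Proof.
move=> fC; rewrite /birkhoff_avg; case: n => [|n].
  by rewrite invr0 mulr0 normr0 (le_trans _ (fC x)).
rewrite normrM normfV normr_nat ler_pdivrMr // mulr_natr.
exact: birkhoff_sum_bound.
Qed.

End BirkhoffSums.

Section Birkhoff.
Context d (X : measurableType d) (R : realType) (mu : probability X R).

Definition limsup_avg_gt (S : X -> X) (f : X -> R) (b : R) : set X :=
  [set x | limsup_gt (fun n => birkhoff_avg S f n x) b].

Lemma measurable_birkhoff_sum S (f : X -> R) n : measurable_fun setT S ->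
  measurable_fun setT f -> measurable_fun setT (birkhoff_sum S f n).
Proof.
move=> mS mf; elim: n => [|n IH].
  rewrite (_ : birkhoff_sum _ _ _ = cst 0); first exact: measurable_cst.
  by apply/funext => x; rewrite /birkhoff_sum big_ord0.
rewrite (_ : birkhoff_sum S f n.+1 = f \+ (birkhoff_sum S f n \o S)).
  by apply: measurable_funD => //; exact: measurableT_comp.
by apply/funext => x; rewrite birkhoff_sumS.
Qed.

Lemma measurable_limsup_avg_gt S (f : X -> R) b : measurable_fun setT S ->
  measurable_fun setT f -> measurable (limsup_avg_gt S f b).
Proof.
move=> mS mf.
rewrite (_ : limsup_avg_gt S f b =
  \bigcup_j \bigcap_m \bigcup_(n in [set n | (m <= n)%N])
     [set x | b + j.+1%:R^-1 <= birkhoff_avg S f n x]); last first.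
  apply/seteqP; split=> x.
    by move=> [j h]; exists j => // m _; have [n [mn hn]] := h m; exists n.
  by move=> [j _ h]; exists j => m; have [n mn hn] := h m I; exists n.
apply: bigcupT_measurable => j; apply: bigcapT_measurable => m.
apply: bigcup_measurable => n _.
have mavg : measurable_fun setT (birkhoff_avg S f n).
  by apply: measurable_funM => //; exact: measurable_birkhoff_sum.
rewrite -[X in measurable X]setTI.
have := @measurable_fun_ler _ _ R setT (cst (b + j.+1%:R^-1)) _ (measurable_cst _) mavg.
move=> /(_ measurableT [set true]); rewrite /preimage /=; exact.
Qed.

(** Moving the starting point one step along the orbit changes a Birkhoff sum by
    two terms, hence the average over [n] terms by O(1/n). *)
Lemma limsup_avg_gt_invariant S (f : X -> R) (C : R) b : (forall x, `|f x| <= C) ->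
  S @^-1` limsup_avg_gt S f b = limsup_avg_gt S f b.
Proof.
move=> fC.
have close n x : `|birkhoff_avg S f n (S x) - birkhoff_avg S f n x| <= 2 * C / n%:R.
  rewrite /birkhoff_avg -mulrBl normrM [X in _ * X]ger0_norm ?invr_ge0 //.
  apply: ler_wpM2r; first by rewrite invr_ge0.
  have -> : birkhoff_sum S f n (S x) - birkhoff_sum S f n x = f (iter n S x) - f x.
    have := birkhoff_sumS S f n x; rewrite birkhoff_sumSr; lra.
  by apply: le_trans (ler_normB _ _) _; rewrite mulr_natl mulr2n lerD.
have transfer x y : (forall n, `|birkhoff_avg S f n y - birkhoff_avg S f n x| <= 2 * C / n%:R) ->
    limsup_avg_gt S f b x -> limsup_avg_gt S f b y.
  move=> cl /limsup_gtP[b' bb' h]; apply/limsup_gtP.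
  exists ((b + b') / 2); first lra.
  have h0 : 2 * C / n%:R @[n --> \oo] --> (2 * C * 0 : R).
    apply: cvgM; first exact: cvg_cst.
    by apply/gtr0_cvgV0; [exists 1%N => // n /= n1; rewrite ltr0n | exact: cvgr_idn].
  move: h0; rewrite mulr0 => /cvgr_lt /(_ ((b' - b) / 2)).
  have : 0 < (b' - b) / 2 by lra.
  move=> /[swap] /[apply] -[m0 _ m0P] m.
  have [n mn hn] := h (maxn m m0); exists n; first by apply: leq_trans mn; exact: leq_maxl.
  have /= := m0P n (leq_trans (leq_maxr _ _) mn).
  have := cl n; rewrite ler_norml; lra.
apply/seteqP; split=> x; rewrite /preimage /=; apply: transfer => n; last exact: close.
by rewrite distrC; exact: close.
Qed.

Lemma limsup_avg_gt_pos S (f : X -> R) b x : limsup_avg_gt S f b x ->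
  exists n, 0 < birkhoff_sum S (fun x => f x - b) n x.
Proof.
move=> /limsup_gtP[b' bb' /(_ 1%N)[n n1 hn]]; exists n.
rewrite birkhoff_sumB_cst -mulr_natr subr_gt0 -ltr_pdivlMr ?ltr0n //.
exact: lt_le_trans hn.
Qed.

Lemma preimage_inverse (S S' : X -> X) (D : set X) : cancel S' S ->
  S @^-1` D = D -> S' @^-1` D = D.
Proof.
move=> SK SD; rewrite -[in RHS]SD -[in LHS]SD; apply/seteqP.
by split=> x; rewrite /preimage /= SK // -[D x](_ : (S @^-1` D) x = _) // SD.
Qed.

Lemma null_of_ge0 (c : R) (m : \bar R) : c < 0 -> (0 <= m)%E ->
  m \is a fin_num -> (0 <= c%:E * m)%E -> m = 0%E.
Proof.
move=> c0; case: m => // r; rewrite -EFinM !lee_fin => r0 _ cr.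
by congr EFin; apply/eqP; rewrite eq_le r0 andbT -(nmulr_rge0 _ c0).
Qed.

(** The set [D] of these points is invariant, so the maximal inequality applies
    on [D] to [f - b] along [S1] and to [a - f] along [S2]; adding the results
    yields 0 <= (a - b) mu(D). Taking for [S1] and [S2] any of a transformation
    and its inverse compares averages over the future with averages over the
    past. *)
Lemma null_upcrossing (S1 S2 : X -> X) (f : X -> R) (C : R) (a b : R) :
  measurable_fun setT S1 -> (forall B, measurable B -> mu (S1 @^-1` B) = mu B) ->
  measurable_fun setT S2 -> (forall B, measurable B -> mu (S2 @^-1` B) = mu B) ->
  (forall D, S1 @^-1` D = D <-> S2 @^-1` D = D) ->
  measurable_fun setT f -> (forall x, `|f x| <= C) -> a < b ->
  mu (limsup_avg_gt S1 f b `&` limsup_avg_gt S2 (fun x => - f x) (- a)) = 0%E.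
Proof.
move=> mS1 inv1 mS2 inv2 S12 mf fC ab.
have mNf : measurable_fun setT (fun x => - f x) by exact: measurableT_comp.
have NfC x : `|- f x| <= C by rewrite normrN.
set D := (X in mu X).
have mD : measurable D by apply: measurableI; exact: measurable_limsup_avg_gt.
have SD : S1 @^-1` D = D.
  rewrite preimage_setI (limsup_avg_gt_invariant _ _ fC); congr (_ `&` _).
  by apply/S12; exact: (limsup_avg_gt_invariant _ _ NfC).
have gC1 x : `|f x - b| <= C + `|b| by apply: le_trans (ler_normB _ _) _; rewrite lerD2r.
have gC2 x : `|- f x - - a| <= C + `|- a| by apply: le_trans (ler_normB _ _) _; rewrite lerD2r.
have mg1 : measurable_fun setT (fun x => f x - b) by apply: measurable_funB.
have mg2 : measurable_fun setT (fun x => - f x - - a) by apply: measurable_funB.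
have H1 := maximal_inequality mS1 inv1 mD SD mg1 gC1
  (fun x Dx => limsup_avg_gt_pos Dx.1).
have H2 := maximal_inequality mS2 inv2 mD ((S12 _).1 SD) mg2 gC2
  (fun x Dx => limsup_avg_gt_pos Dx.2).
have := adde_ge0 H1 H2; rewrite -integralD //; last 2 first.
- exact: (bounded_integrable mu mD mg1 gC1).
- exact: (bounded_integrable mu mD mg2 gC2).
under eq_integral.
  move=> x _; rewrite -EFinD (_ : f x - b + (- f x - - a) = a - b); last by ring.
  over.
rewrite integral_cst // => ge0.
apply: null_of_ge0 ge0 => //; last exact: fin_num_measure.
by rewrite subr_lt0.
Qed.

(** The forward and backward averages have the same limit because
    [null_upcrossing] compares them directly with each other, no less than with
    themselves. *)
Theorem birkhoff_two_sided (S S' : X -> X) (f : X -> R) (C : R) :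
  cancel S S' -> cancel S' S ->
  measurable_fun setT S -> measurable_fun setT S' ->
  (forall B, measurable B -> mu (S @^-1` B) = mu B) ->
  measurable_fun setT f -> (forall x, `|f x| <= C) ->
  {ae mu, forall x, exists l : R,
    birkhoff_avg S f n x @[n --> \oo] --> l /\
    birkhoff_avg S' f n x @[n --> \oo] --> l}.
Proof.
move=> SK S'K mS mS' inv mf fC.
have inv' B : measurable B -> mu (S' @^-1` B) = mu B.
  move=> mB; rewrite -[in RHS](_ : S @^-1` (S' @^-1` B) = B).
    by rewrite inv // -[X in measurable X]setTI; exact: mS'.
  by apply/seteqP; split=> x; rewrite /preimage /= SK.
have SS' D : S @^-1` D = D <-> S' @^-1` D = D by split; exact: preimage_inverse.
have S'S D : S' @^-1` D = D <-> S @^-1` D = D by split; exact: preimage_inverse.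
have null S1 S2 :
  measurable_fun setT S1 -> (forall B, measurable B -> mu (S1 @^-1` B) = mu B) ->
  measurable_fun setT S2 -> (forall B, measurable B -> mu (S2 @^-1` B) = mu B) ->
  (forall D, S1 @^-1` D = D <-> S2 @^-1` D = D) ->
  {ae mu, forall x,
    limsup_le_liminf (birkhoff_avg S1 f ^~ x) (birkhoff_avg S2 f ^~ x)}.
  move=> m1 i1 m2 i2 S12.
  have : {ae mu, forall x, forall n,
    if choice.unpickle n is Some ab then (ab : rat * rat).1 < ab.2 ->
    ~ (limsup_gt (birkhoff_avg S1 f ^~ x) (ratr ab.2) /\
       limsup_gt (fun n => - birkhoff_avg S2 f n x) (- ratr ab.1)) else True}.
    apply: ae_foralln => n; case: (choice.unpickle n) => [[a b]|]; last exact: aeW.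
    have [ab|nab] := boolP (a < b); last by apply: aeW.
    exists (limsup_avg_gt S1 f (ratr b) `&` limsup_avg_gt S2 (fun x => - f x) (- ratr a)).
    split.
    - apply: measurableI; apply: measurable_limsup_avg_gt => //.
      exact: measurableT_comp.
    - by apply: null_upcrossing fC _ => //; rewrite ltr_rat.
    - move=> x /= /not_implyP[_ /contrapT[h1 h2]]; split => //.
      move: h2; rewrite /limsup_avg_gt /=.
      by under [X in _ -> limsup_gt X _]eq_fun do rewrite birkhoff_avgN.
  apply: filterS => x h a b ab; have := h (choice.pickle (a, b)).
  by rewrite choice.pickleK; exact.
have n1 := null S S' mS inv mS' inv' SS'.
have n2 := null S S mS inv mS inv (fun=> iff_refl _).
have n3 := null S' S mS' inv' mS inv S'S.
apply: filterS3 n1 n2 n3 => x h1 h2 h3.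
by apply: (@cvg_same_limit _ _ _ C) => // n; exact: birkhoff_avg_bound.
Qed.
End Birkhoff.

(** * From an invariant finitely additive probability to an invariant measure *)

Section Content.
Variables (R : realType) (X : ptopologicalType) (m : set X -> R).
Hypothesis hausX : hausdorff_space X.
Hypothesis cptX : compact [set: X].
Hypothesis m_ge0 : forall A, 0 <= m A.
Hypothesis m_setT : m setT = 1.
Hypothesis m_setU : forall A B, A `&` B = set0 -> m (A `|` B) = m A + m B.

Lemma content_set0 : m set0 = 0.
Proof.
by have := @m_setU set0 set0 (setI0 _); rewrite setU0 -{1}[m set0]addr0 => /addrI.
Qed.

Lemma le_content A B : A `<=` B -> m A <= m B.
Proof.
move=> AB; rewrite -(setDUK AB) m_setU; first by rewrite lerDl.
by apply/seteqP; split=> x //= [? []].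
Qed.

Lemma content_setU_le A B : m (A `|` B) <= m A + m B.
Proof.
have -> : A `|` B = A `|` (B `\` A).
  apply/seteqP; split=> x /=; last by tauto.
  by case: (pselect (A x)); tauto.
rewrite m_setU; first by rewrite lerD2l le_content //; exact: subDsetl.
by apply/seteqP; split=> x //= [? []].
Qed.

(** Together with [outer_content], this is Halmos's passage from a content on
    closed sets to a regular outer measure: an open set is measured by the closed
    sets inside it, an arbitrary set by the open sets around it. *)
Definition inner_content (U : set X) : R :=
  sup [set m K | K in [set K | closed K /\ K `<=` U]].

Lemma le_inner_content K U : closed K -> K `<=` U -> m K <= inner_content U.
Proof.
move=> cK KU; apply: ub_le_sup; last by exists K.
by exists 1 => _ [A _ <-]; rewrite -m_setT le_content.
Qed.

Lemma inner_content_le U c : (forall K, closed K -> K `<=` U -> m K <= c) ->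
  inner_content U <= c.
Proof.
move=> h; apply: ge_sup; last by move=> _ [K [cK KU] <-]; exact: h.
by exists (m set0), set0 => //; split; [exact: closed0|exact: sub0set].
Qed.

Lemma inner_content_ge0 U : 0 <= inner_content U.
Proof. by rewrite -content_set0 le_inner_content //; exact: closed0. Qed.


(** Normality encloses [K `\` U] in a neighborhood whose closure lies in [V]. *)
Lemma closed_split (K U V : set X) : closed K -> open U -> open V -> K `<=` U `|` V ->
  exists K1 K2, [/\ closed K1, closed K2, K1 `<=` U, K2 `<=` V & K = K1 `|` K2].
Proof.
move=> cK oU oV KUV.
have cKU : closed (K `&` ~` U) by apply: closedI => //; exact: open_closedC.
have KUnV : set_nbhs (K `&` ~` U) V.
  move=> x [Kx nUx]; apply: open_nbhs_nbhs; split => //.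
  by have [] := KUV _ Kx.
have [W KW WV] := compact_normal hausX cptX cKU KUnV.
exists (K `&` ~` W^°), (K `&` closure W); split.
- by apply: closedI => //; apply: open_closedC; exact: open_interior.
- by apply: closedI => //; exact: closed_closure.
- move=> x [Kx nWx]; apply: contrapT => nUx; apply: nWx; exact: KW.
- by move=> x [_ /WV].
- apply/seteqP; split=> x /=; last by tauto.
  move=> Kx; case: (pselect (W^° x)) => Wx; [right|by left].
  by split => //; apply: subset_closure; exact: interior_subset Wx.
Qed.

Lemma inner_content_setU U V : open U -> open V ->
  inner_content (U `|` V) <= inner_content U + inner_content V.
Proof.
move=> oU oV; apply: inner_content_le => K cK KUV.
have [K1 [K2 [c1 c2 K1U K2V ->]]] := closed_split cK oU oV KUV.
by apply: le_trans (content_setU_le _ _) _; apply: lerD; exact: le_inner_content.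
Qed.

Lemma inner_content_bigsetU (U : nat -> set X) n : (forall i, open (U i)) ->
  inner_content (\big[setU/set0]_(i < n) U i) <= \sum_(i < n) inner_content (U i).
Proof.
move=> oU; elim: n => [|n IH].
  rewrite !big_ord0; apply: inner_content_le => K _ K0.
  by rewrite -content_set0 le_content.
rewrite !big_ord_recr /=; apply: le_trans (lerD IH (lexx _)).
by apply: inner_content_setU => //; elim/big_ind : _ => //; [exact: open0|exact: openU].
Qed.

(** Countable subadditivity comes from compactness: a closed subset of the union
    is covered by finitely many of the open sets. *)
Lemma inner_content_bigcup (U : nat -> set X) : (forall i, open (U i)) ->
  ((inner_content (\bigcup_i U i))%:E <= \sum_(i <oo) (inner_content (U i))%:E)%E.
Proof.
move=> oU.
have pos n : (0%N <= n)%N -> true -> (0 <= (inner_content (U n))%:E)%E.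
  by move=> _ _; rewrite lee_fin inner_content_ge0.
have [->|fin] := eqVneq (\sum_(i <oo) (inner_content (U i))%:E)%E +oo%E.
  by rewrite leey.
have sfin : (\sum_(i <oo) (inner_content (U i))%:E \is a fin_num)%E.
  rewrite fin_numE fin andbT gt_eqF // (lt_le_trans (ltNyr 0)) //.
  exact: nneseries_ge0.
rewrite -(fineK sfin) lee_fin; apply: inner_content_le => K cK KU.
rewrite -lee_fin (fineK sfin).
have cptK : compact K by apply: subclosed_compact cptX _.
move: cptK; rewrite compact_cover => /(_ nat setT U (fun i _ => oU i)) [].
  by rewrite /cover.
move=> D _ KD.
have [N DN] : exists N, forall i : nat, i \in D -> (i < N)%N.
  exists (\max_(i <- D) i).+1 => i iD; rewrite ltnS.
  exact: (@leq_bigmax_seq _ _ _ (fun i => i)).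
apply: le_trans (_ : (\sum_(0 <= i < N) (inner_content (U i))%:E <= _)%E); last first.
  exact: nneseries_lim_ge.
rewrite sumEFin lee_fin big_mkord.
apply: le_trans (inner_content_bigsetU N oU); apply: le_inner_content => // x /KD.
rewrite /cover -bigcup_mkord => -[i iD Ux]; exists i => //=; exact: DN.
Qed.

Definition outer_content (A : set X) : R :=
  inf [set inner_content U | U in [set U | open U /\ A `<=` U]].

Lemma outer_content_le A U : open U -> A `<=` U -> outer_content A <= inner_content U.
Proof.
move=> oU AU; apply: ge_inf; last by exists U.
by exists 0 => _ [V _ <-]; exact: inner_content_ge0.
Qed.

Lemma le_outer_content A c : (forall U, open U -> A `<=` U -> c <= inner_content U) ->
  c <= outer_content A.
Proof.
move=> h; apply: lb_le_inf; last by move=> _ [U [oU AU] <-]; exact: h.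
by exists (inner_content setT), setT => //; split => //; exact: openT.
Qed.

Lemma outer_content_ge0 A : 0 <= outer_content A.
Proof. by apply: le_outer_content => U _ _; exact: inner_content_ge0. Qed.

Lemma outer_content_adherent A e : 0 < e ->
  exists U, [/\ open U, A `<=` U & inner_content U < outer_content A + e].
Proof.
move=> e0; have hi : has_inf [set inner_content U | U in [set U | open U /\ A `<=` U]].
  split; first by exists (inner_content setT), setT => //; split => //; exact: openT.
  by exists 0 => _ [V _ <-]; exact: inner_content_ge0.
by have [_ [U [oU AU] <-]] := inf_adherent e0 hi; exists U.
Qed.

Definition outer_measure_of (A : set X) : \bar R := (outer_content A)%:E.

Lemma outer_content_set0 : outer_measure_of set0 = 0%E.
Proof.
congr EFin; apply/eqP; rewrite eq_le outer_content_ge0 andbT.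
apply: le_trans (outer_content_le open0 (@subset_refl _ _)) _.
by apply: inner_content_le => K _ K0; rewrite -content_set0 le_content.
Qed.

Lemma outer_content_sigma_subadditive : sigma_subadditive outer_measure_of.
Proof.
move=> F; apply/lee_addgt0Pr => e e0.
apply: le_trans (epsilon_trick xpredT _ (ltW e0)); last first.
  by move=> n; rewrite lee_fin outer_content_ge0.
have eps n : 0 < e / (2 ^ n.+1)%:R by rewrite divr_gt0 // ltr0n expn_gt0.
have /choice[U hU] := fun n => outer_content_adherent (F n) (eps n).
have oU n : open (U n) by have [] := hU n.
apply: (@le_trans _ _ (inner_content (\bigcup_i U i))%:E).
  rewrite lee_fin outer_content_le //; first exact: bigcup_open.
  by apply: subset_bigcup => n _; have [] := hU n.
apply: le_trans (inner_content_bigcup oU) _.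
apply: lee_nneseries => n _; first by rewrite lee_fin inner_content_ge0.
by rewrite /outer_measure_of -EFinD lee_fin; have [_ _ /ltW] := hU n.
Qed.

Lemma le_outer_measure_of : {homo outer_measure_of : A B / A `<=` B >-> (A <= B)%E}.
Proof.
move=> A B AB; rewrite lee_fin; apply: le_outer_content => U oU BU.
by apply: outer_content_le => //; exact: subset_trans BU.
Qed.

Lemma outer_measure_of_ge0 A : (0 <= outer_measure_of A)%E.
Proof. by rewrite lee_fin outer_content_ge0. Qed.

HB.instance Definition _ := isOuterMeasure.Build R X outer_measure_of
  outer_content_set0 outer_measure_of_ge0 le_outer_measure_of
  outer_content_sigma_subadditive.

(** For an open [V] containing the test set [Y], choose a closed [K] inside
    [V `&` U] that nearly has its content, then a closed [L] inside
    [V `\` K], which is open and contains [Y `\` U]. The disjoint closed sets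
    [K] and [L] both lie in [V]. *)
Lemma open_caratheodory (U : set X) : open U -> outer_measure_of.-caratheodory U.
Proof.
move=> oU; apply: le_caratheodory_measurable => Y; rewrite -EFinD lee_fin.
apply: le_outer_content => V oV YV.
rewrite -lerBrDr; apply: le_trans (outer_content_le (openI oV oU) (setSI YV)) _.
apply: inner_content_le => K cK KVU; rewrite lerBrDr addrC -lerBrDr.
have oVK : open (V `&` ~` K) by apply: openI => //; exact: closed_openC.
apply: (@le_trans _ _ (inner_content (V `&` ~` K))).
  apply: outer_content_le => // x [Yx nUx]; split; first exact: YV.
  by move=> /KVU[].
apply: inner_content_le => L cL LVK; rewrite lerBrDr -m_setU.
  apply: le_inner_content; first exact: closedU.
  by rewrite subUset; split=> x; [move=> /LVK[]|move=> /KVU[]].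
by apply/seteqP; split=> x //= [/LVK[]].
Qed.

Lemma borel_caratheodory (B : set (borel X)) : measurable B ->
  outer_measure_of.-caratheodory B.
Proof.
apply: smallest_sub; last exact: open_caratheodory.
have [h0 hC hU] := @sigma_algebra_measurable _ (caratheodory_type outer_measure_of).
by split => //.
Qed.

Definition content_measure : set (borel X) -> \bar R := outer_measure_of.

Lemma content_measure_sigma_additive : semi_sigma_additive content_measure.
Proof.
move=> F mF tF mUF.
apply: (@caratheodory_measure_sigma_additive R X outer_measure_of F) => //.
  by move=> i; apply: borel_caratheodory.
exact: borel_caratheodory.
Qed.

HB.instance Definition _ := isMeasure.Build _ (borel X) R content_measure
  outer_content_set0 outer_measure_of_ge0 content_measure_sigma_additive.

Lemma content_measure_setT : content_measure setT = 1%E.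
Proof.
congr EFin; apply/eqP; rewrite eq_le; apply/andP; split.
  apply: le_trans (outer_content_le openT (@subset_refl _ _)) _.
  by apply: inner_content_le => K _ _; rewrite -m_setT le_content.
apply: le_outer_content => U _ TU.
by rewrite -m_setT le_inner_content //; exact: closedT.
Qed.

HB.instance Definition _ := Measure_isProbability.Build _ (borel X) R content_measure
  content_measure_setT.

(** The construction commutes with any homeomorphism that preserves [m], which
    gives the invariance of the measure. Closed sets can only gain mass, because
    they are measured by the open sets around them. *)
Theorem content_regularization (T : homeo X) : (forall A, m (T @^-1` A) = m A) ->
  exists mu : probability (borel X) R, invariant_measure T mu /\
    forall K, closed K -> ((m K)%:E <= mu K)%E.
Proof.
move=> m_inv; exists content_measure; split; last first.
  move=> K cK; rewrite lee_fin; apply: le_outer_content => U _ KU.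
  exact: le_inner_content.
have m_inv' A : m (homeo_inv T @^-1` A) = m A.
  by rewrite -m_inv; congr m; apply/seteqP; split=> x; rewrite /preimage /= homeoK.
have inner_le (S S' : X -> X) U : continuous S' -> cancel S S' -> cancel S' S ->
    (forall A, m (S @^-1` A) = m A) -> (forall A, m (S' @^-1` A) = m A) ->
    inner_content (S @^-1` U) <= inner_content U.
  move=> cS SK SK' inv inv'; apply: inner_content_le => K cK KU; rewrite -inv'.
  apply: le_inner_content; first by apply: preimage_closed.
  by move=> x /KU; rewrite /preimage /= SK'.
have inner_inv U : inner_content (T @^-1` U) = inner_content U.
  apply/eqP; rewrite eq_le (inner_le _ (homeo_inv T)) //=.
  - rewrite -[in leLHS](_ : homeo_inv T @^-1` (T @^-1` U) = U).
      apply: (inner_le _ T) => //;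
        [exact: homeo_continuous|exact: homeoVK|exact: homeoK].
    by apply/seteqP; split=> x; rewrite /preimage /= homeoVK.
  - exact: homeo_inv_continuous.
  - exact: homeoK.
  - exact: homeoVK.
have outer_le (S S' : X -> X) A : continuous S' -> cancel S S' -> cancel S' S ->
    (forall U, inner_content (S' @^-1` U) = inner_content U) ->
    outer_content A <= outer_content (S @^-1` A).
  move=> cS SK SK' inv; apply: le_outer_content => U oU AU; rewrite -inv.
  apply: outer_content_le; first by apply: open_comp.
  by move=> x Ax; apply: AU; rewrite /preimage /= SK'.
have inner_inv' U : inner_content (homeo_inv T @^-1` U) = inner_content U.
  by rewrite -inner_inv; congr inner_content; apply/seteqP; split=> x; rewrite /preimage /= homeoK.
move=> B _; congr EFin; apply/eqP; rewrite eq_le; apply/andP; split; last first.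
  apply: (outer_le _ (homeo_inv T)) => //;
    [exact: homeo_inv_continuous|exact: homeoK|exact: homeoVK].
have e : homeo_inv T @^-1` (T @^-1` B) = B.
  by apply/seteqP; split=> x; rewrite /preimage /= homeoVK.
rewrite -[in leRHS]e.
apply: (outer_le _ T) => //;
  [exact: homeo_continuous|exact: homeoVK|exact: homeoK].
Qed.
End Content.

(** * Limits of empirical means *)

Definition upper_semicontinuous (R : realType) (X : topologicalType) (f : X -> R) :=
  forall t : R, closed [set x | t <= f x].

Lemma closed_measurable_borel (X : ptopologicalType) (K : set (borel X)) :
  closed (K : set X) -> measurable K.
Proof.
move=> cK; rewrite -[K]setCK; apply: measurableC.
by apply: sub_sigma_algebra; exact: closed_openC.
Qed.

Lemma upper_semicontinuous_measurable (R : realType) (X : ptopologicalType)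
    (f : borel X -> R) :
  upper_semicontinuous (f : X -> R) -> measurable_fun setT f.
Proof.
move=> uf; apply: (measurability (@RGenCInfty.G R)) => [|/= _ [_] [r] -> <-].
  exact: RGenCInfty.measurableE.
rewrite setTI; apply: closed_measurable_borel.
rewrite (_ : _ @^-1` _ = [set x | r <= f x]) //.
by apply/seteqP; split=> x; rewrite /preimage /= in_itv /= andbT.
Qed.

Lemma continuous_measurable_borel (X : ptopologicalType) (T : X -> X) :
  continuous T -> measurable_fun setT (T : borel X -> borel X).
Proof.
move=> cT; apply: (@measurability _ _ (borel X) (borel X) setT T (@open X)) => // _ [U oU <-].
by rewrite setTI; apply: sub_sigma_algebra; exact: open_comp.
Qed.

Lemma ultra_cvg_bounded (R : realType) (U : set_system nat) (u : nat -> R) (C : R) :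
  UltraFilter U -> (forall k, `|u k| <= C) -> cvg (u k @[k --> U]).
Proof.
move=> uU uC; have UC : (u k @[k --> U]) `[- C, C]%classic.
  by apply: (@filterE _ U) => k; rewrite /= in_itv /= -ler_norml.
have [l [_ cl]] := segment_compact (fmap_proper_filter _ _) UC.
apply: (cvgP l) => B Bl.
have [//|nB] := in_ultra_setVsetC (u @^-1` B) uU.
by have [y [nBy By]] := cl (~` B) B nB Bl.
Qed.

Section Empirical.
Variables (R : realType) (X : ptopologicalType) (T : homeo X).
Variables (U : set_system nat) (x_ : nat -> X) (n_ : nat -> nat).
Hypothesis ultraU : UltraFilter U.
Hypothesis n_infty : forall N, \forall k \near U, (N <= n_ k)%N.

(** A limit along an ultrafilter is defined for all bounded functions at once,
    without passing to a subsequence; its values on indicators form an invariant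
    finitely additive probability on all subsets of [X]. *)
Definition empirical_mean (f : X -> R) : R :=
  lim (birkhoff_avg (homeo_fun T) f (n_ k) (x_ k) @[k --> U]).

Definition bounded_by (C : R) (f : X -> R) := forall x, `|f x| <= C.

Lemma empirical_mean_cvg C f : bounded_by C f ->
  birkhoff_avg (homeo_fun T) f (n_ k) (x_ k) @[k --> U] --> empirical_mean f.
Proof.
by move=> fC; apply: ultra_cvg_bounded ultraU _ => k; exact: birkhoff_avg_bound fC.
Qed.

Lemma empirical_mean_eq f l :
  birkhoff_avg (homeo_fun T) f (n_ k) (x_ k) @[k --> U] --> l ->
  empirical_mean f = l.
Proof. by move/cvg_lim; exact. Qed.

Lemma empirical_meanD C D f g : bounded_by C f -> bounded_by D g ->
  empirical_mean (f \+ g) = empirical_mean f + empirical_mean g.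
Proof.
move=> fC gD; apply: empirical_mean_eq.
under eq_cvg do rewrite /birkhoff_avg /birkhoff_sum big_split /= mulrDl.
exact: cvgD (empirical_mean_cvg fC) (empirical_mean_cvg gD).
Qed.

Lemma empirical_meanZ C f a : bounded_by C f ->
  empirical_mean (fun x => a * f x) = a * empirical_mean f.
Proof.
move=> fC; apply: empirical_mean_eq.
under eq_cvg do rewrite /birkhoff_avg /birkhoff_sum -mulr_sumr -mulrA.
exact: cvgMr (empirical_mean_cvg fC).
Qed.

Lemma empirical_mean_cst c : empirical_mean (fun=> c) = c.
Proof.
apply: empirical_mean_eq; apply: cvg_near_cst.
near=> k; rewrite /birkhoff_avg /birkhoff_sum sumr_const card_ord -[c *+ _]mulr_natr mulfK //.
by rewrite pnatr_eq0 -lt0n; near: k; exact: n_infty.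
Unshelve. all: by end_near.
Qed.

Lemma le_emp_mean C D f g : bounded_by C f -> bounded_by D g ->
  (forall x, f x <= g x) -> empirical_mean f <= empirical_mean g.
Proof.
move=> fC gD fg; apply: ler_lim; [exact: empirical_mean_cvg fC|exact: empirical_mean_cvg gD|].
apply: nearW => k; rewrite /birkhoff_avg ler_wpM2r ?invr_ge0 //.
exact: ler_sum.
Qed.

Lemma empirical_mean_ge C f c : bounded_by C f ->
  (forall e, 0 < e -> \forall k \near U,
    c - e <= birkhoff_avg (homeo_fun T) f (n_ k) (x_ k)) ->
  c <= empirical_mean f.
Proof.
move=> fC h; apply/ler_addgt0Pl => e e0; rewrite -lerBlDl.
exact: limr_ge (empirical_mean_cvg fC) (h e e0).
Qed.

Lemma empirical_mean_comp C f : bounded_by C f ->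
  empirical_mean (f \o T) = empirical_mean f.
Proof.
move=> fC; apply: empirical_mean_eq.
(* The two sums differ by boundary terms, negligible as [n_ k] grows. *)
have h0 : (fun k => f (iter (n_ k) T (x_ k)) - f (x_ k)) \*
    (fun k => (n_ k)%:R^-1) @ U --> (0 : R).
  apply/cvgrPdist_le => e e0; near=> k; rewrite /= sub0r normrN normrM normfV normr_nat.
  have nk : (0 < (n_ k)%:R :> R) by rewrite ltr0n; near: k; exact: n_infty.
  rewrite ler_pdivrMr // (@le_trans _ _ (2 * C)) //.
    by apply: le_trans (ler_normB _ _) _; rewrite mulr_natl mulr2n lerD.
  rewrite [leRHS]mulrC -ler_pdivrMr //.
  apply: (@le_trans _ _ (Num.truncn (2 * C / e)).+1%:R).
    exact/ltW/truncnS_gt.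
  by rewrite ler_nat; near: k; exact: n_infty.
have -> : (fun k => birkhoff_avg (homeo_fun T) (f \o T) (n_ k) (x_ k)) =
   (fun k => birkhoff_avg (homeo_fun T) f (n_ k) (x_ k)) \+
   ((fun k => f (iter (n_ k) T (x_ k)) - f (x_ k)) \* (fun k => (n_ k)%:R^-1)).
  apply/funext => k /=; rewrite /birkhoff_avg -mulrDl; congr (_ * _).
  have := birkhoff_sumS (homeo_fun T) f (n_ k) (x_ k); rewrite birkhoff_sumSr.
  have -> : birkhoff_sum (homeo_fun T) f (n_ k) (T (x_ k)) =
      birkhoff_sum (homeo_fun T) (f \o T) (n_ k) (x_ k).
    by apply: eq_bigr => i _; rewrite -iterSr.
  lra.
by rewrite -[empirical_mean f]addr0; apply: cvgD h0; exact: empirical_mean_cvg fC.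
Unshelve. all: by end_near.
Qed.

Hypothesis hausX : hausdorff_space X.
Hypothesis cptX : compact [set: X].

Lemma indic_bounded (A : set X) : bounded_by 1 (\1_A).
Proof. by move=> x; rewrite indicE normr_nat; case: (_ \in _); rewrite ?ler01. Qed.

(** The regularized measure gives a closed set at least its limiting frequency,
    and the superlevel sets of an upper semicontinuous function are closed;
    decomposing [f] into layers turns the first inequality into the second. *)
Theorem empirical_limit_measure :
  exists mu : probability (borel X) R, invariant_measure T mu /\
  forall f C, upper_semicontinuous f -> bounded_by C f ->
    ((empirical_mean f)%:E <= \int[mu]_x (f x)%:E)%E.
Proof.
have [||||mu [invmu muK]] :=
  @content_regularization R X (fun A => empirical_mean \1_A) hausX cptX _ _ _ T.
- move=> A; rewrite -[leLHS](empirical_mean_cst 0).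
  apply: (@le_emp_mean 0 1); [by move=> x; rewrite normr0|exact: indic_bounded|].
  by move=> x; rewrite indicE ler0n.
- by rewrite -[RHS]empirical_mean_cst; congr empirical_mean; apply/funext => x; rewrite indicT.
- move=> A B AB; rewrite -(empirical_meanD (@indic_bounded A) (@indic_bounded B)).
  congr empirical_mean; apply/funext => x /=; rewrite !indicE in_setU.
  case: (boolP (x \in A)) => xA; case: (boolP (x \in B)) => xB; rewrite ?addr0 ?add0r //.
  have : (A `&` B) x by split; exact: set_mem.
  by rewrite AB.
- move=> A; rewrite -(empirical_mean_comp (@indic_bounded A)); congr empirical_mean.
exists mu; split => // f C uf fC.
have mf : measurable_fun setT (f : borel X -> R) by exact: upper_semicontinuous_measurable.
pose good (s : borel X -> R) := [/\ measurable_fun setT s, exists D, bounded_by D s &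
  ((empirical_mean s)%:E <= \int[mu]_x (s x)%:E)%E].
have C0 : 0 <= C by apply: le_trans (fC point).
suff approx e : 0 < e -> exists s,
    [/\ good s, forall x, s x <= f x + C & forall x, f x + C <= s x + e].
  apply/lee_addgt0Pr => e e0.
  have [s [[ms [D sD] sI] sf fs]] := approx e e0.
  have i1 := bounded_integrable mu measurableT mf fC.
  have iC : mu.-integrable setT (EFin \o (cst C : borel X -> R)).
    by apply: (@bounded_integrable _ _ _ mu setT (cst C) `|C|).
  have is_ := bounded_integrable mu measurableT ms sD.
  have fCD : bounded_by (C + C) (f \+ cst C).
    by move=> x; apply: le_trans (ler_normD _ _) _; rewrite lerD // ger0_norm.
  have E1 : empirical_mean f + C <= empirical_mean s + e.
    rewrite -[C](empirical_mean_cst C) -[e in leRHS]empirical_mean_cst.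
    rewrite -(@empirical_meanD C C) //; last by move=> x; rewrite ger0_norm.
    rewrite -(@empirical_meanD D e) //; last by move=> x; rewrite ger0_norm // ltW.
    apply: (@le_emp_mean (C + C) (D + e)) => //.
    by move=> x; apply: le_trans (ler_normD _ _) _; rewrite lerD // ger0_norm // ltW.
  have E2 : (\int[mu]_x (s x)%:E <= \int[mu]_x (f x)%:E + C%:E)%E.
    apply: (@le_trans _ _ (\int[mu]_x ((f x)%:E + C%:E))%E).
      apply: le_integral => //; first exact: integrableD.
      by move=> x _; rewrite -EFinD lee_fin.
    rewrite integralD // [X in (_ + X <= _)%E]integral_cst //.
    by rewrite [X in (_ * X)%E](@probability_setT _ (borel X) R mu) mule1.
  have := le_trans sI E2.
  have If : (\int[mu]_x (f x)%:E \is a fin_num)%E by exact: integrable_fin_num.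
  rewrite -(fineK If) -!EFinD !lee_fin; lra.
move=> e0.
(* [s K] is [f + C] rounded down to a multiple of [e] and truncated at [K * e];
   its layers are indicators of superlevel sets of [f], which are closed. *)
pose s := fix s K :=
  if K is K'.+1 then s K' \+ (fun x => e * \1_[set x | K'.+1%:R * e - C <= f x] x)
  else (fun _ : X => 0 : R).
have goods K : good (s K).
  elim: K => [|K [ms [D sD] sI]].
    split; first exact: measurable_cst.
      by exists 0 => x; rewrite normr0.
    by rewrite empirical_mean_cst integral0.
  set A := [set x | K.+1%:R * e - C <= f x].
  have mA : measurable (A : set (borel X)) by apply: closed_measurable_borel; exact: uf.
  have m1 : measurable_fun setT (\1_A : borel X -> R) by exact: measurable_indic.
  have mA1 : measurable_fun setT (fun x : borel X => e * \1_A x : R) by apply: measurable_funM.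
  have bA : bounded_by e (fun x => e * \1_A x).
    move=> x; rewrite normrM ger0_norm ?(ltW e0) // ler_piMr ?(ltW e0) //.
    exact: indic_bounded.
  split; first by apply: measurable_funD.
    by exists (D + e) => x; apply: le_trans (ler_normD _ _) _; rewrite lerD //; exact: bA.
  rewrite (empirical_meanD sD bA) (empirical_meanZ e (@indic_bounded A)) EFinD.
  have i1 := bounded_integrable mu measurableT ms sD.
  have i2 := bounded_integrable mu measurableT mA1 bA.
  have i3 := bounded_integrable mu measurableT m1 (@indic_bounded A).
  rewrite [leRHS](_ : _ = (\int[mu]_x (s K x)%:E + e%:E * mu A)%E).
    by rewrite leeD // EFinM lee_pmul2l //; apply: muK; exact: uf.
  rewrite (integralD measurableT i1 i2); congr (_ + _)%E.
  rewrite -[in RHS](setIT A) -(integral_indic mu measurableT mA).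
  by rewrite -(integralZl measurableT i3).
have sle K x : s K x <= f x + C /\
    (K%:R * e - C <= f x -> s K x = K%:R * e) /\
    (f x <= K%:R * e - C -> f x + C <= s K x + e).
  elim: K => [|K [h1 [h2 h3]]] /=.
    have := fC x; rewrite ler_norml mul0r => /andP[]; split; [lra|split => //]; lra.
  rewrite indicE; have [] := boolP (x \in _).
    move=> /set_mem /=; rewrite -natr1 mulrDl mul1r => fx; rewrite mulr1.
    have -> : s K x = K%:R * e by apply: h2; lra.
    split; [lra|split; lra].
  move=> nx; have : f x < K.+1%:R * e - C.
    by rewrite ltNge; apply/negP => h; move/negP: nx; apply; exact: mem_set.
  rewrite mulr0 addr0 -natr1 mulrDl mul1r => fx; split => //; split; first lra.
  move=> _; have [Kf|fK] := leP (K%:R * e - C) (f x); last by apply: h3; lra.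
  by rewrite h2 //; lra.
exists (s (Num.truncn (2 * C / e)).+1); split => //.
  by move=> x; have [] := sle (Num.truncn (2 * C / e)).+1 x.
move=> x; have [_ [_ h]] := sle (Num.truncn (2 * C / e)).+1 x; apply: h.
have : 2 * C / e < (Num.truncn (2 * C / e)).+1%:R by exact: truncnS_gt.
rewrite ltr_pdivrMr //; have := fC x; rewrite ler_norml; lra.
Qed.
End Empirical.

(** * Iterates and sums of increments *)

Section HomeoIter.
Variables (X : topologicalType) (T : homeo X).

Lemma homeo_iterN (n : nat) x : homeo_iter T (- n%:Z) x = iter n (homeo_inv T) x.
Proof. by case: n. Qed.

Lemma homeo_iterS (n : int) x : homeo_iter T (n + 1) x = T (homeo_iter T n x).
Proof.
case: n => [n|[|n]].
- by rewrite -PoszD addn1.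
- by rewrite [homeo_iter T (Negz 0) x]/= homeoVK.
- have -> : Negz n.+1 + 1 = Negz n by lia.
  by rewrite /homeo_iter [in RHS]iterS homeoVK.
Qed.

Lemma homeo_iter_add (m n : int) x :
  homeo_iter T (m + n) x = homeo_iter T n (homeo_iter T m x).
Proof.
elim/int_ind: n => [|n IH|n IH]; first by rewrite addr0.
- have -> : m + n.+1%:Z = m + n%:Z + 1 by lia.
  have -> : n.+1%:Z = n%:Z + 1 :> int by lia.
  by rewrite !homeo_iterS IH.
- apply: (can_inj (homeoK T)); rewrite -!homeo_iterS.
  have -> : m - n.+1%:Z + 1 = m - n%:Z by lia.
  by have -> : - n.+1%:Z + 1 = - n%:Z by lia.
Qed.

Lemma homeo_iterK (n : int) : cancel (homeo_iter T n) (homeo_iter T (- n)).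
Proof. by move=> x; rewrite -homeo_iter_add addrN. Qed.

Lemma homeo_iter_continuous (n : int) : continuous (homeo_iter T n).
Proof.
have it (S : X -> X) k : continuous S -> continuous (iter k S).
  move=> cS; elim: k => [|k IH] x /=; first exact: cvg_id.
  by apply: continuous_comp; [exact: IH|exact: cS].
by case: n => n; apply: it; [exact: homeo_continuous|exact: homeo_inv_continuous].
Qed.
End HomeoIter.

Lemma sum_increments (R : realType) (u : nat -> R) (n N : nat) :
  \sum_(m < n) (u (m + N)%N - u m) = \sum_(j < N) (u (n + j)%N - u j).
Proof.
elim: n => [|n IH].
  by rewrite big_ord0 big1 // => j _; rewrite add0n subrr.
rewrite big_ord_recr /= IH.
rewrite [RHS](_ : _ = \sum_(j < N)
  ((u (n + j)%N - u j) + (u (n + j.+1)%N - u (n + j)%N))).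
  rewrite [RHS]big_split /=; congr (_ + _).
  rewrite -(big_mkord xpredT (fun j => u (n + j.+1)%N - u (n + j)%N)).
  by rewrite (telescope_sumr (fun j => u (n + j)%N)) // addn0.
by apply: eq_bigr => j _; rewrite addSnnS; ring.
Qed.

Section Increments.
Variables (R : realType) (u : nat -> R) (C : R).
Hypothesis u0 : u 0%N = 0.
Hypothesis u_lip : forall m n, `|u (m + n)%N - u m| <= C * n%:R.

(** Summing the increments of [u] over windows of length [N] telescopes to about
    [N] times [u n]. Applied to a cocycle this averages, over the starting point
    modulo [N], the decompositions of an orbit segment into blocks of length
    [N]. *)
Lemma approx_sum_increments n N :
  `|N%:R * u n - \sum_(m < n) (u (m + N)%N - u m)| <= 2 * C * N%:R ^+ 2.
Proof.
have C0 : 0 <= C by have := u_lip 0 1; rewrite mulr1; apply: le_trans.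
rewrite sum_increments mulr_natl -[X in u n *+ X]card_ord -sumr_const -sumrB.
apply: le_trans (ler_norm_sum _ _ _) _.
apply: (@le_trans _ _ (\sum_(j < N) 2 * C * N%:R)); last first.
  by rewrite sumr_const card_ord -[leLHS]mulr_natr expr2 mulrA.
apply: ler_sum => j _.
have jN : j%:R <= N%:R :> R by rewrite ler_nat ltnW.
have := u_lip n j; have := u_lip 0 j; rewrite add0n u0 subr0 => h1 h2.
have h3 : C * j%:R <= C * N%:R by exact: ler_wpM2l.
move: h1 h2; rewrite !ler_norml; lra.
Qed.

Lemma sum_approx_increments (w : nat -> R) eta n N :
  (forall m, `|u (m + N)%N - u m - w m| <= eta) ->
  `|N%:R * u n - \sum_(m < n) w m| <= n%:R * eta + 2 * C * N%:R ^+ 2.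
Proof.
move=> h; have := approx_sum_increments n N.
have : `|\sum_(m < n) (u (m + N)%N - u m) - \sum_(m < n) w m| <= n%:R * eta.
  rewrite -sumrB; apply: le_trans (ler_norm_sum _ _ _) _.
  by rewrite mulr_natl -[X in _ *+ X]card_ord -sumr_const; exact: ler_sum.
rewrite !ler_norml; lra.
Qed.

Lemma sum_le_increments (w : nat -> R) n N :
  (forall m, u (m + N)%N - u m <= w m) ->
  N%:R * u n <= \sum_(m < n) w m + 2 * C * N%:R ^+ 2.
Proof.
move=> h; have := approx_sum_increments n N.
have : \sum_(m < n) (u (m + N)%N - u m) <= \sum_(m < n) w m by exact: ler_sum.
rewrite ler_norml; lra.
Qed.
End Increments.

Lemma cvg_nat_inv (R : realType) (c : R) : c / n%:R @[n --> \oo] --> (0 : R).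
Proof.
rewrite -[X in _ --> X](mulr0 c); apply: cvgM; first exact: cvg_cst.
by apply/gtr0_cvgV0; [exists 1%N => // n /= n1; rewrite ltr0n | exact: cvgr_idn].
Qed.

Lemma common_limit (R : realType) (u v : nat -> R) :
  (forall e, 0 < e -> exists l, \forall n \near \oo,
    `|u n - l| <= e /\ `|v n - l| <= e) ->
  exists l : R, u @ \oo --> l /\ v @ \oo --> l.
Proof.
move=> h.
have cu : cvg (u @ \oo).
  apply: cauchy_cvg; apply/cauchy_ballP => e e0.
  have [l hl] := h (e / 4) (divr_gt0 e0 (ltr0Sn _ 3)).
  rewrite near_map2; near=> m n.
  have [um _] : `|u m - l| <= e / 4 /\ `|v m - l| <= e / 4 by near: m.
  have [un _] : `|u n - l| <= e / 4 /\ `|v n - l| <= e / 4 by near: n.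
  rewrite /ball /= ltr_norml; move: um un; rewrite !ler_norml; lra.
have uv : (v \- u) @ \oo --> (0 : R).
  apply/cvgr0Pnorm_le => e e0; have [l hl] := h (e / 4) (divr_gt0 e0 (ltr0Sn _ 3)).
  near=> n; have [] : `|u n - l| <= e / 4 /\ `|v n - l| <= e / 4 by near: n.
  rewrite /= !ler_norml; lra.
exists (lim (u @ \oo)); split => //.
rewrite [X in X @ _](_ : v = u \+ (v \- u)).
  by rewrite -[X in _ --> X]addr0; exact: cvgD.
by apply/funext => n /=; rewrite addrC subrK.
Unshelve. all: by end_near.
Qed.

(** * Subadditive cocycles over a homeomorphism *)

Lemma ae_imply d (X : measurableType d) (R : realType) (mu : probability X R)
  (P Q : X -> Prop) : (forall x, P x -> Q x) ->
  {ae mu, forall x, P x} -> {ae mu, forall x, Q x}.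
Proof. by move=> PQ; apply: filterS. Qed.

Section Cocycle.
Variables (R : realType) (X : ptopologicalType) (T : homeo X).
Variables (a : int -> X -> R) (C : R).
Hypothesis a_sub : forall m n x, a (m + n) x <= a m x + a n (homeo_iter T m x).
Hypothesis a_bound : forall n x, `|a n x| <= C * `|n|%N%:R.
Hypothesis a_usc : forall n, upper_semicontinuous (a n).

(** When [a n x] is the maximal logarithmic growth of vectors over [x] under the
    [n]-th iterate of an automorphism, this is the quasiconformal distortion of
    that iterate: the second term is minus the minimal growth. *)
Definition distortion (n : nat) (x : X) : R := a n%:Z x + a (- n%:Z) (iter n T x).

Let S' := homeo_inv T.

Lemma cocycle_bound_ge0 : 0 <= C.
Proof. by have := a_bound 1 point; rewrite mulr1; apply: le_trans. Qed.

Lemma cocycle0 x : a 0 x = 0.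
Proof. by have := a_bound 0 x; rewrite mulr0 normr_le0 => /eqP. Qed.

Lemma cocycle_bound_nat (n : nat) x : `|a n%:Z x| <= C * n%:R.
Proof. exact: a_bound. Qed.

Lemma cocycle_bound_natN (n : nat) x : `|a (- n%:Z) x| <= C * n%:R.
Proof. by apply: le_trans (a_bound _ _) _; rewrite abszN. Qed.

Lemma cocycle_sub m n x : a (m + n)%N%:Z x <= a m%:Z x + a n%:Z (iter m T x).
Proof. by rewrite PoszD; exact: a_sub. Qed.

Lemma cocycle_subN m n x :
  a (- (m + n)%N%:Z) x <= a (- m%:Z) x + a (- n%:Z) (iter m S' x).
Proof. by rewrite PoszD opprD -(homeo_iterN T); exact: a_sub. Qed.

Lemma cocycle_sub_back m n x :
  a m%:Z x <= a (m + n)%N%:Z x + a (- n%:Z) (iter (m + n) T x).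
Proof.
have := a_sub (m + n)%N%:Z (- n%:Z) x.
by rewrite (_ : (m + n)%N%:Z - n%:Z = m%:Z) // PoszD addrK.
Qed.

Lemma cocycle_subN_back m n x :
  a (- m%:Z) x <= a (- (m + n)%N%:Z) x + a n%:Z (iter (m + n) S' x).
Proof.
have := a_sub (- (m + n)%N%:Z) n%:Z x.
rewrite (_ : - (m + n)%N%:Z + n%:Z = - m%:Z); last by rewrite PoszD; lia.
by rewrite homeo_iterN.
Qed.

Lemma cocycle_lip m n x : `|a (m + n)%N%:Z x - a m%:Z x| <= C * n%:R.
Proof.
have := cocycle_sub m n x; have := cocycle_sub_back m n x.
have := cocycle_bound_nat n (iter m T x); have := cocycle_bound_natN n (iter (m + n) T x).
rewrite !ler_norml; lra.
Qed.

Lemma cocycle_lipN m n x : `|a (- (m + n)%N%:Z) x - a (- m%:Z) x| <= C * n%:R.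
Proof.
have := cocycle_subN m n x; have := cocycle_subN_back m n x.
have := cocycle_bound_natN n (iter m S' x); have := cocycle_bound_nat n (iter (m + n) S' x).
rewrite !ler_norml; lra.
Qed.

Lemma iter_SK n x : iter n T (iter n S' x) = x.
Proof. by rewrite -(homeo_iterN T) -[iter n T]/(homeo_iter T n%:Z) -homeo_iter_add addNr. Qed.

Lemma iter_KS n x : iter n S' (iter n T x) = x.
Proof. by rewrite -(homeo_iterN T) -[iter n T]/(homeo_iter T n%:Z) -homeo_iter_add addrN. Qed.

Lemma distortion0 x : distortion 0 x = 0.
Proof. by rewrite /distortion oppr0 !cocycle0 addr0. Qed.

Lemma distortion_sub m n x :
  distortion (m + n) x <= distortion m x + distortion n (iter m T x).
Proof.
rewrite /distortion.
have h1 := cocycle_sub m n x.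
have := cocycle_subN n m (iter (m + n) T x).
rewrite [(n + m)%N]addnC (addnC m n) !iterD iter_KS => h2.
rewrite addnC in h1; lra.
Qed.

Lemma distortion_lip m n x : `|distortion (m + n) x - distortion m x| <= 2 * C * n%:R.
Proof.
rewrite /distortion.
have h1 := cocycle_lip m n x.
have := cocycle_subN n m (iter (m + n) T x).
rewrite (addnC m n) !iterD iter_KS => h2.
have h4 := cocycle_bound_natN n (iter n T (iter m T x)).
have := a_sub n%:Z (- (n + m)%N%:Z) (iter m T x).
rewrite (_ : n%:Z - (n + m)%N%:Z = - m%:Z); last by rewrite PoszD; lia.
rewrite /= => h3; have h5 := cocycle_bound_nat n (iter m T x).
rewrite addnC in h1.
move: h1 h4 h5; rewrite !ler_norml; lra.
Qed.

Lemma distortion_le n x : distortion n x <= 2 * C * n%:R.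
Proof. by have := distortion_lip 0 n x; rewrite distortion0 subr0 ler_norml => /andP[]. Qed.

(** A large distortion over a long orbit segment forces a large average, along
    this segment, of the distortion over any fixed time [N]. *)
Lemma distortion_avg N n x : (0 < n)%N ->
  N%:R * (distortion n x / n%:R) <=
  birkhoff_avg (homeo_fun T) (distortion N) n x + 2 * (2 * C) * N%:R ^+ 2 / n%:R.
Proof.
move=> n0; have n0' : 0 < n%:R :> R by rewrite ltr0n.
rewrite /birkhoff_avg -mulrDl mulrA ler_pM2r ?invr_gt0 //.
apply: (@sum_le_increments _ (fun m => distortion m x) (2 * C) (distortion0 x)
  (fun m k => distortion_lip m k x) (fun m => distortion N (iter m T x))).
by move=> m; rewrite lerBlDl; exact: distortion_sub.
Qed.

(** What the maximal growth over [x] retains of a two-sided exponent common to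
    all vectors over [x]; see [max_growth_limit] and, for a converse under a
    bound on the distortion, [growth_limit]. *)
Definition regular (x : X) := exists l : R,
  a n%:Z x / n%:R @[n --> \oo] --> l /\ a (- n%:Z) x / n%:R @[n --> \oo] --> - l.

Hypothesis hausX : hausdorff_space X.
Hypothesis cptX : compact [set: X].

Lemma integrable_cocycle (mu : probability (borel X) R) n :
  mu.-integrable setT (EFin \o (a n : borel X -> R)).
Proof.
apply: (bounded_integrable mu measurableT _ (a_bound n)).
exact: upper_semicontinuous_measurable (@a_usc n).
Qed.

(** Otherwise the distortion exceeds [eps * n] along arbitrarily long orbit
    segments. By [distortion_avg] the empirical means along these segments of the
    distortion over time [N] tend to at least [N * eps] for every [N], and so does
    the integral of [a N + a (- N)] for a limit measure. Regularity almost
    everywhere contradicts this, as it makes [(a N + a (- N)) / N] tend to 0.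
    By invariance of the means, the two terms of the distortion can be evaluated
    at the same point. *)
Theorem uniform_distortion_of_regular :
  (forall mu : probability (borel X) R, invariant_measure T mu ->
    {ae mu, forall x : borel X, regular x}) ->
  forall eps, 0 < eps -> exists c, 0 < c /\
    forall x n, distortion n x <= c + eps * n%:R.
Proof.
move=> reg eps eps0; apply: contrapT => no_c.
have /choice[xn xnP] : forall k : nat, exists xn : X * nat,
    k.+1%:R + eps * xn.2%:R < distortion xn.2 xn.1.
  move=> k; apply: contrapT => nk; apply: no_c; exists k.+1%:R; split => // x n.
  by rewrite leNgt; apply/negP => h; apply: nk; exists (x, n).
(* The lengths [n_ k] tend to infinity because the distortion over time [n] is at
   most [2 * C * n], while it exceeds [k]. *)
pose x_ k := (xn k).1; pose n_ k := (xn k).2.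
have [U [ultraU ooU]] := ultraFilterLemma (@eventually_filter).
have n_infty N : \forall k \near U, (N <= n_ k)%N.
  apply: ooU; exists (Num.truncn (2 * C * N%:R)).+1 => // k /= Nk.
  rewrite leqNgt; apply/negP => nN; have := xnP k; rewrite ltNge => /negP; apply.
  apply: le_trans (distortion_le _ _) _; rewrite -[leLHS]addr0 lerD ?mulr_ge0 ?(ltW eps0) //.
  apply: (@le_trans _ _ (2 * C * N%:R)).
    by apply: ler_wpM2l; [rewrite mulr_ge0 // cocycle_bound_ge0|rewrite ler_nat ltnW].
  apply: (@le_trans _ _ (Num.truncn (2 * C * N%:R)).+1%:R); first exact/ltW/truncnS_gt.
  by rewrite ler_nat ltnW // ltnS.
have [mu [invmu muP]] := @empirical_limit_measure R X T U x_ n_ ultraU n_infty hausX cptX.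
have emp_iter N (C' : R) (f : X -> R) : bounded_by C' f ->
    empirical_mean T U x_ n_ (fun x => f (iter N T x)) = empirical_mean T U x_ n_ f.
  move=> fC; elim: N => [|N IH] //; rewrite -IH.
  have fC' : bounded_by C' (fun x => f (iter N T x)) by move=> x; exact: fC.
  rewrite -(empirical_mean_comp T x_ ultraU n_infty fC'); congr empirical_mean.
  by apply/funext => x; rewrite /= -iterSr.
have aC N : bounded_by (C * N%:R) (a N%:Z) by move=> x; exact: cocycle_bound_nat.
have aCN N : bounded_by (C * N%:R) (a (- N%:Z)) by move=> x; exact: cocycle_bound_natN.
have key N : (0 < N)%N ->
    ((N%:R * eps)%:E <= \int[mu]_x (a N%:Z x + a (- N%:Z) x)%:E)%E.
  move=> N0.
  have e1 : empirical_mean T U x_ n_ (distortion N) =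
      empirical_mean T U x_ n_ (a N%:Z) + empirical_mean T U x_ n_ (a (- N%:Z)).
    rewrite -(emp_iter N _ _ (aCN N)).
    exact: (empirical_meanD T x_ n_ ultraU (aC N) (fun x => aCN N (iter N T x))).
  have kC : bounded_by (2 * C * N%:R) (distortion N).
    move=> x; have := aC N x; have := aCN N (iter N T x).
    rewrite /distortion !ler_norml; lra.
  have e2 : N%:R * eps <= empirical_mean T U x_ n_ (distortion N).
    apply: (empirical_mean_ge ultraU kC) => e e0.
    pose D := 2 * (2 * C) * N%:R ^+ 2.
    near=> k.
    have nk : (0 < n_ k)%N by near: k; exact: n_infty.
    have nk' : 0 < (n_ k)%:R :> R by rewrite ltr0n.
    have := distortion_avg N (x_ k) nk; rewrite -/D.
    have : D / (n_ k)%:R <= e.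
      rewrite ler_pdivrMr // mulrC -ler_pdivrMr //.
      apply: (@le_trans _ _ (Num.truncn (D / e)).+1%:R); first exact/ltW/truncnS_gt.
      by rewrite ler_nat; near: k; exact: n_infty.
    have : N%:R * eps <= N%:R * (distortion (n_ k) (x_ k) / (n_ k)%:R).
      apply: ler_wpM2l => //; rewrite ler_pdivlMr // ltW //.
      by apply: lt_trans (xnP k); rewrite ltrDr.
    lra.
  apply: (@le_trans _ _ (empirical_mean T U x_ n_ (distortion N))%:E); first by rewrite lee_fin.
  under eq_integral do rewrite EFinD.
  rewrite e1 EFinD integralD //; try exact: integrable_cocycle.
  by apply: leeD; [exact: muP (@a_usc _) (aC N)|exact: muP (@a_usc _) (aCN N)].
pose f N (x : borel X) := (a N.+1%:Z x + a (- N.+1%:Z) x) / N.+1%:R.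
have ma n : measurable_fun setT (a n : borel X -> R).
  exact: upper_semicontinuous_measurable (@a_usc n).
have fC N x : `|f N x| <= 2 * C.
  rewrite /f normrM normfV normr_nat ler_pdivrMr //.
  have := aC N.+1 x; have := aCN N.+1 x; rewrite !ler_norml; lra.
have mf N : measurable_fun setT (f N).
  by apply: measurable_funM => //; apply: measurable_funD.
have cvgf : {ae mu, forall x : borel X, setT x -> f N x @[N --> \oo] --> (0 : R)}.
  apply: ae_imply (reg mu invmu) => x [l [h1 h2]] _.
  rewrite -(subrr l) /f; under eq_cvg do rewrite mulrDl.
  move: h1 h2; rewrite -(cvg_shiftS (fun n => a n%:Z x / n%:R)).
  rewrite -(cvg_shiftS (fun n => a (- n%:Z) x / n%:R)) => h1' h2'.
  exact: cvgD h1' h2'.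
have m0 : measurable_fun setT (cst 0 : borel X -> R) by exact: measurable_cst.
have := bounded_convergence measurableT mf m0 fC cvgf.
rewrite integral0 => cvg0.
have : (eps%:E <= 0)%E.
  rewrite -(cvg_lim _ cvg0) //; apply: lime_ge; first exact: cvgP cvg0.
  apply: nearW => N; rewrite /f.
  under eq_integral do rewrite mulrC EFinM.
  rewrite integralZl //; last first.
    under [X in integrable _ _ X]eq_fun do rewrite EFinD.
    by apply: integrableD => //; exact: integrable_cocycle.
  rewrite -lee_pdivrMl //.
  by rewrite invrK -EFinM; exact: key.
by rewrite lee_fin leNgt eps0.
Unshelve. all: by end_near.
Qed.

Lemma distortion_back m N x : a (- N%:Z) (iter m S' x) =
  distortion N (iter (m + N) S' x) - a N%:Z (iter (m + N) S' x).
Proof.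
by rewrite /distortion addrAC subrr add0r addnC iterD iter_SK.
Qed.

Lemma birkhoff_sum_iter (S : X -> X) (f : X -> R) D n N x : bounded_by D f ->
  `|birkhoff_sum S f n (iter N S x) - birkhoff_sum S f n x| <= 2 * D * N%:R.
Proof.
move=> fD; elim: N => [|N IH]; first by rewrite subrr normr0 mulr0.
have := birkhoff_sumS S f n (iter N S x); rewrite birkhoff_sumSr -iterS => h.
have := fD (iter n S (iter N S x)); have := fD (iter N S x).
move: IH; rewrite -natr1 !ler_norml; lra.
Qed.

Section Uniform.
Hypothesis unif : forall eps, 0 < eps -> exists c, 0 < c /\
    forall x n, distortion n x <= c + eps * n%:R.

(** A small distortion makes [a] nearly additive: [a (m + N) x - a m x] differs
    from [a N (T^m x)] by at most the distortion over time [N], so [a n x / n]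
    stays within that distortion divided by [N] of the Birkhoff averages of
    [a N / N]. Backwards, [- a (- n) x / n] is compared in the same way with the
    Birkhoff averages of [a N / N] in the past. *)
Lemma regular_of_birkhoff x :
  (forall N : nat, exists l : R,
     birkhoff_avg (homeo_fun T) (a N%:Z) n x @[n --> \oo] --> l /\
     birkhoff_avg S' (a N%:Z) n x @[n --> \oo] --> l) -> regular x.
Proof.
move=> hN.
suff [l [h1 h2]] : exists l : R, a n%:Z x / n%:R @[n --> \oo] --> l /\
    - (a (- n%:Z) x / n%:R) @[n --> \oo] --> l.
  exists l; split => //; apply/cvgNP; rewrite opprK; exact: h2.
apply: common_limit => e e0.
have [c [c0 cP]] := unif (divr_gt0 e0 (ltr0Sn _ 7)).
(* [N] is large enough for the constant [c] to be at most [e / 8 * N]. *)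
pose N := (Num.truncn (8 * c / e)).+1.
have N0 : 0 < N%:R :> R by rewrite ltr0n.
have cN : c <= e / 8 * N%:R.
  have : 8 * c / e < N%:R by exact: truncnS_gt.
  rewrite ltr_pdivrMr //; lra.
pose eta := c + e / 8 * N%:R.
have eta_le : eta <= e / 4 * N%:R by rewrite /eta; lra.
have [l [hf hb]] := hN N.
exists (l / N%:R).
have CN : bounded_by (C * N%:R) (a N%:Z) by move=> y; exact: cocycle_bound_nat.
pose D := 4 * C * N%:R ^+ 2.
have D0 : 0 <= D by rewrite /D !mulr_ge0 ?cocycle_bound_ge0 // exprn_ge0.
have fwd n : `|N%:R * a n%:Z x - birkhoff_sum (homeo_fun T) (a N%:Z) n x| <= n%:R * eta + D.
  have H : `|N%:R * a n%:Z x - birkhoff_sum (homeo_fun T) (a N%:Z) n x| <=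
      n%:R * eta + 2 * C * N%:R ^+ 2.
    apply: (@sum_approx_increments _ (fun m => a m%:Z x) C (cocycle0 x)
      (fun m k => cocycle_lip m k x) (fun m => a N%:Z (iter m T x))) => m.
    have := cocycle_sub m N x; have := cocycle_sub_back m N x.
    have := cP (iter m T x) N; rewrite -/eta /distortion -iterD [(N + m)%N]addnC.
    move=> ? ? ?; rewrite ler_norml; lra.
  apply: le_trans H _; rewrite lerD2l /D.
  have : 0 <= C * N%:R ^+ 2 by rewrite mulr_ge0 ?cocycle_bound_ge0 // exprn_ge0.
  lra.
have bwd n : `|N%:R * a (- n%:Z) x + birkhoff_sum S' (a N%:Z) n x| <= n%:R * eta + D.
  have := birkhoff_sum_iter S' n N x CN.
  have := @sum_approx_increments _ (fun m => a (- m%:Z) x) C (cocycle0 x)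
    (fun m k => cocycle_lipN m k x) (fun m => - a N%:Z (iter (m + N) S' x)) eta n N _.
  have -> : \sum_(m < n) - a N%:Z (iter (m + N) S' x) =
      - birkhoff_sum S' (a N%:Z) n (iter N S' x).
    by rewrite sumrN; congr (- _); apply: eq_bigr => i _; rewrite -iterD.
  move=> H; have {H} : `|N%:R * a (- n%:Z) x - - birkhoff_sum S' (a N%:Z) n (iter N S' x)| <=
     n%:R * eta + 2 * C * N%:R ^+ 2.
    apply: H => m; have := cocycle_subN m N x; have := cocycle_subN_back m N x.
    rewrite distortion_back; have := cP (iter (m + N) S' x) N; rewrite -/eta.
    move=> ? ? ?; rewrite ler_norml; lra.
  rewrite /D !ler_norml !expr2; lra.
have evf : \forall n \near \oo, `|birkhoff_avg (homeo_fun T) (a N%:Z) n x - l| <= e / 4 * N%:R.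
  by move/cvgrPdistC_le: hf; apply; rewrite mulr_gt0 // divr_gt0.
have evb : \forall n \near \oo, `|birkhoff_avg S' (a N%:Z) n x - l| <= e / 4 * N%:R.
  by move/cvgrPdistC_le: hb; apply; rewrite mulr_gt0 // divr_gt0.
have evD : \forall n \near \oo, `|D / n%:R| <= e / 4 * N%:R.
  by move/cvgr0Pnorm_le: (@cvg_nat_inv R D); apply; rewrite mulr_gt0 // divr_gt0.
near=> n.
have n0 : (0 < n)%N by near: n; exists 1%N.
have n0' : 0 < n%:R :> R by rewrite ltr0n.
have e1 : `|birkhoff_avg (homeo_fun T) (a N%:Z) n x - l| <= e / 4 * N%:R by near: n.
have e2 : `|birkhoff_avg S' (a N%:Z) n x - l| <= e / 4 * N%:R by near: n.
have e3 : D / n%:R <= e / 4 * N%:R.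
  by apply: le_trans (ler_norm _) _; near: n.
have main (u : R) s : `|N%:R * u - s| <= n%:R * eta + D ->
    `|s / n%:R - l| <= e / 4 * N%:R ->
    `|u / n%:R - l / N%:R| <= e.
  move=> h1 h2.
  have h3 : `|N%:R * (u / n%:R) - s / n%:R| <= eta + D / n%:R.
    rewrite mulrA -mulrBl normrM normfV normr_nat ler_pdivrMr // mulrDl divfK ?gt_eqF //.
    by rewrite [eta * _]mulrC.
  have h4 : `|N%:R * (u / n%:R) - l| <= e * N%:R.
    move: h2 h3; rewrite !ler_norml; lra.
  rewrite -(ler_pM2r N0) -[X in _ * X <= _]normr_nat -normrM mulrBl divfK ?gt_eqF //.
  by rewrite [X in X - _]mulrC.
split; first exact: main (fwd n) e1.
rewrite -mulNr; apply: main e2.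
by rewrite mulrN -opprD normrN; exact: bwd.
Unshelve. all: by end_near.
Qed.

Theorem regular_of_uniform_distortion (mu : probability (borel X) R) :
  invariant_measure T mu -> {ae mu, forall x : borel X, regular x}.
Proof.
move=> inv.
have : {ae mu, forall x : borel X, forall N : nat, exists l : R,
     birkhoff_avg (homeo_fun T) (a N%:Z) n x @[n --> \oo] --> l /\
     birkhoff_avg S' (a N%:Z) n x @[n --> \oo] --> l}.
  apply: ae_foralln => N.
  apply: (@birkhoff_two_sided _ (borel X) R mu (homeo_fun T) S' (a N%:Z) (C * N%:R)).
  - exact: homeoK.
  - exact: homeoVK.
  - exact: continuous_measurable_borel (@homeo_continuous _ T).
  - exact: continuous_measurable_borel (@homeo_inv_continuous _ T).
  - exact: inv.
  - exact: upper_semicontinuous_measurable (@a_usc _).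
  - by move=> x; exact: cocycle_bound_nat.
by apply: ae_imply => x; exact: regular_of_birkhoff.
Qed.
End Uniform.
End Cocycle.

(** * Fiber norms and iterates of an automorphism *)

Section FiberNorm.
Variables (R : realType) (X : topologicalType) (E : vector_bundle R X).
Variable g : riemannian_metric E.

Lemma metricDl x (u v w : fiber E x) :
  g (inc E (u + v), inc E w) = g (inc E u, inc E w) + g (inc E v, inc E w).
Proof. by have := metric_linear g w 1 u v; rewrite scale1r mul1r. Qed.

Lemma metric0l x (w : fiber E x) : g (inc E (0 : fiber E x), inc E w) = 0.
Proof. by have := metricDl 0 0 w; rewrite addr0 -[LHS]addr0 => /addrI. Qed.

Lemma metricZl x c (u w : fiber E x) :
  g (inc E (c *: u), inc E w) = c * g (inc E u, inc E w).
Proof. by have := metric_linear g w c u 0; rewrite addr0 metric0l addr0. Qed.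

Lemma metric_ge0 x (v : fiber E x) : 0 <= g (inc E v, inc E v).
Proof.
by have [->|/metric_gt0 h] := eqVneq v 0; [rewrite metric0l|exact: ltW].
Qed.

Lemma tnorm_ge0 e : 0 <= tnorm g e.
Proof. exact: sqrtr_ge0. Qed.

Lemma fnormZ x c (v : fiber E x) : tnorm g (inc E (c *: v)) = `|c| * tnorm g (inc E v).
Proof.
rewrite /tnorm metricZl Defs.metric_sym metricZl mulrA -expr2.
by rewrite sqrtrM ?sqr_ge0 // sqrtr_sqr.
Qed.

Lemma fnorm_gt0 x (v : fiber E x) : v != 0 -> 0 < tnorm g (inc E v).
Proof. by move=> v0; rewrite sqrtr_gt0 metric_gt0. Qed.

Lemma fnorm0 x : tnorm g (inc E (0 : fiber E x)) = 0.
Proof. by rewrite /tnorm metric0l sqrtr0. Qed.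

(** The parallelogram law yields this weak triangle inequality, whose constants
    are invisible in exponential growth rates. *)
Lemma fnormD2 x (u v : fiber E x) :
  tnorm g (inc E (u + v)) <= 2 * (tnorm g (inc E u) + tnorm g (inc E v)).
Proof.
have expand (s t : fiber E x) : g (inc E (s + t), inc E (s + t)) =
    g (inc E s, inc E s) + 2 * g (inc E s, inc E t) + g (inc E t, inc E t).
  rewrite metricDl (Defs.metric_sym g s) (Defs.metric_sym g t) !metricDl (Defs.metric_sym g t s).
  by ring.
have h1 := expand u v; have h2 := expand u (- v).
have hN (s : fiber E x) : g (inc E s, inc E (- v)) = - g (inc E s, inc E v).
  by rewrite Defs.metric_sym -scaleN1r metricZl mulN1r Defs.metric_sym.
have hNN : g (inc E (- v), inc E (- v)) = g (inc E v, inc E v).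
  by rewrite hN Defs.metric_sym hN opprK.
rewrite hNN hN in h2.
have h3 := metric_ge0 (u - v).
have a0 := tnorm_ge0 (inc E u); have b0 := tnorm_ge0 (inc E v).
have sq (s : fiber E x) : tnorm g (inc E s) ^+ 2 = g (inc E s, inc E s).
  by rewrite sqr_sqrtr // metric_ge0.
rewrite -(@ler_pXn2r _ 2) // ?nnegrE ?tnorm_ge0 ?mulr_ge0 ?addr_ge0 //.
rewrite sq h1; rewrite h2 in h3.
have ab := mulr_ge0 a0 b0; have := sq u; have := sq v; rewrite !expr2.
move: ab h3 a0 b0.
move: (tnorm g (inc E u)) (tnorm g (inc E v)) (g _) (g _) (g _) => a b p q r.
nra.
Qed.

Lemma fnorm_sum x n (w : 'I_n -> fiber E x) :
  tnorm g (inc E (\sum_i w i)) <= 2 ^+ n * \sum_i tnorm g (inc E (w i)).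
Proof.
elim: n w => [|n IH] w; first by rewrite !big_ord0 fnorm0 mulr0.
rewrite !big_ord_recr /=; apply: le_trans (fnormD2 _ _) _.
have h := IH (fun i => w (widen_ord (leqnSn n) i)).
have h1 : 1 <= 2 ^+ n :> R by rewrite exprn_ege1 // ler1n.
have h2 := tnorm_ge0 (inc E (w ord_max)).
rewrite exprS -mulrA ler_pM2l // mulrDr lerD //.
by rewrite ler_peMl.
Qed.

Lemma tnorm_continuous : continuous (tnorm g).
Proof.
move=> e; rewrite /tnorm; apply: continuous_comp; last exact: sqrt_continuous.
have /subspace_continuousP := @metric_continuous _ _ _ g.
move=> /(_ (e, e) erefl) h B /h.
rewrite /nbhs /= /within /= => -[[P Q] [/= Pe Qe] PQ].
near=> e'; apply: (PQ (e', e')) => //=; split => /=; near: e'; assumption.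
Unshelve. all: by end_near.
Qed.
End FiberNorm.

Section AutIter.
Variables (R : realType) (X : topologicalType) (E : vector_bundle R X).
Variables (T : homeo X) (A : aut E T).

Lemma proj_aut e : Defs.proj (A e) = T (Defs.proj e).
Proof. by have [v <-] := inc_surj e; rewrite autE !proj_inc. Qed.

Lemma proj_aut_inv e : Defs.proj (homeo_inv A e) = homeo_inv T (Defs.proj e).
Proof. by rewrite -{2}(homeoVK A e) proj_aut homeoK. Qed.

Lemma proj_aut_iter n e : Defs.proj (homeo_iter A n e) = homeo_iter T n (Defs.proj e).
Proof.
case: n => n; rewrite /homeo_iter.
  by elim: n => //= n <-; rewrite proj_aut.
by elim: n.+1 => //= m <-; rewrite proj_aut_inv.
Qed.

Lemma aut_inv_linear x : exists y (L : 'Hom(fiber E x, fiber E y)),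
  forall v, homeo_inv A (inc E v) = inc E (L v).
Proof.
rewrite -(homeoVK T x); set y := homeo_inv T x; exists y, ((aut_fib A y)^-1)%VF => v.
apply: (can_inj (homeoK A)).
have [h h1 h2] := aut_fib_bij A y.
have ker0 : lker (aut_fib A y) == 0%VS by apply/lker0P; exact: can_inj h1.
rewrite homeoVK autE.
by rewrite -[v in RHS]h2 (lker0_lfunK ker0) h2.
Qed.

(** For [n < 0] the target fiber is known only up to an equality of base points,
    which the existential quantifier on [y] hides. *)
Lemma aut_iter_linear n x : exists y (L : 'Hom(fiber E x, fiber E y)),
  forall v, homeo_iter A n (inc E v) = inc E (L v).
Proof.
case: n => n; rewrite /homeo_iter.
  elim: n => [|n [y [L LP]]]; first by exists x, \1%VF => v; rewrite id_lfunE.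
  exists (T y), (aut_fib A y \o L)%VF => v.
  by rewrite iterS LP autE comp_lfunE.
elim: n.+1 => [|m [y [L LP]]]; first by exists x, \1%VF => v; rewrite id_lfunE.
have [z [L' L'P]] := aut_inv_linear y; exists z, (L' \o L)%VF => v.
by rewrite iterS LP L'P comp_lfunE.
Qed.
End AutIter.

(** * Compact families of nonzero vectors of a subbundle *)

Section Trivialization.
Variables (R : realType) (X : topologicalType) (E : vector_bundle R X).
Variables (V : forall x, {vspace fiber E x}) (r : nat) (U : set X).
Variables (h : Defs.total E -> 'rV[R]_r) (s : X * 'rV[R]_r -> Defs.total E).
Hypothesis triv : trivialization (@inc R X E) V U h s.

Lemma triv0 x : U x -> h (inc E (0 : fiber E x)) = 0.
Proof.
case: triv => _ _ lin _ _ Ux.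
have := lin x Ux 1 0 0 (mem0v _) (mem0v _).
by rewrite scaler0 addr0 scale1r -[LHS]addr0 => /addrI.
Qed.

Lemma trivD x (a : R) (v w : fiber E x) : U x -> v \in V x -> w \in V x ->
  h (inc E (a *: v + w)) = a *: h (inc E v) + h (inc E w).
Proof. by case: triv => _ _ lin _ _ Ux Vv Vw; exact: lin. Qed.

Lemma trivZ x (a : R) (v : fiber E x) : U x -> v \in V x ->
  h (inc E (a *: v)) = a *: h (inc E v).
Proof.
by move=> Ux Vv; have := trivD a Ux Vv (mem0v _); rewrite addr0 triv0 // addr0.
Qed.

Lemma triv_inj x (v w : fiber E x) : U x -> v \in V x -> w \in V x ->
  h (inc E v) = h (inc E w) -> v = w.
Proof.
case: triv => _ _ _ hs _ Ux Vv Vw e.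
apply: (@Defs.inc_inj R X E x); by rewrite -(hs _ _ Ux Vv) -(hs _ _ Ux Vw) e.
Qed.

Lemma triv_section x (c : 'rV[R]_r) : U x ->
  exists v : fiber E x, [/\ v \in V x, s (x, c) = inc E v & h (inc E v) = c].
Proof.
case: triv => _ _ _ _ sh Ux; have [hc [v Vv e]] := sh x c Ux.
by exists v; rewrite -e.
Qed.
End Trivialization.

Definition nonzero_vectors (R : realType) (X : topologicalType)
    (E : vector_bundle R X) (V : forall x, {vspace fiber E x}) : set (Defs.total E) :=
  [set e | exists x (v : fiber E x), [/\ v \in V x, v != 0 & e = inc E v]].

Lemma nonzero_vectors_at (R : realType) (X : topologicalType)
    (E : vector_bundle R X) (V : forall x, {vspace fiber E x}) e x :
  nonzero_vectors V e -> Defs.proj e = x ->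
  exists v : fiber E x, [/\ v \in V x, v != 0 & e = inc E v].
Proof.
by move=> [y [v [Vv v0 ->]]]; rewrite proj_inc => <-; exists v.
Qed.

Lemma sphere_compact (R : realType) r : compact [set c : 'rV[R]_r | `|c| = 1].
Proof.
apply: bounded_closed_compact.
  by exists 1; split; [exact: num_real|] => M M1 c /= ->; exact: ltW.
rewrite (_ : [set c | _] = (fun c : 'rV[R]_r => `|c|) @^-1` [set 1]) //.
by apply: preimage_closed; [move=> c _; exact: norm_continuous|exact: closed_eq].
Qed.

Section CompactRepresentatives.
Variables (R : realType) (X : ptopologicalType) (E : vector_bundle R X).
Variables (V : forall x, {vspace fiber E x}).
Hypothesis subV : subbundle V.
Hypothesis hausX : hausdorff_space X.
Hypothesis cptX : compact [set: X].

(** [Q] has the role of a unit sphere bundle over [W]: it is compact and meets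
    every line of [V] over [W]. *)
Definition representatives (W : set X) (Q : set (Defs.total E)) :=
  [/\ compact Q, Q `<=` nonzero_vectors V &
    forall x (v : fiber E x), W x -> v \in V x -> v != 0 ->
      exists2 c : R, c != 0 & Q (inc E (c *: v))].

(** The local section maps the product of a closed neighborhood of [x0] and of
    the unit sphere onto such a set. *)
Lemma local_representatives x0 : exists W Q, [/\ open W, W x0 & representatives W Q].
Proof.
case: subV => r /(_ x0)[U [h [s [oU Ux0 triv]]]].
have cx0 : closed [set x0] by apply: compact_closed => //; exact: compact_set1.
have nU : set_nbhs [set x0] U by move=> x ->; apply: open_nbhs_nbhs.
have [W nW WU] := compact_normal hausX cptX cx0 nU.
have WU' x : closure W x -> U x by move=> /WU.
exists W^°, (s @` (closure W `*` [set c | `|c| = 1])); split.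
- exact: open_interior.
- exact: nW.
split.
- apply: continuous_compact; last first.
    apply: compact_setX; last exact: sphere_compact.
    exact: subclosed_compact (@closed_closure _ _) cptX _.
  case: triv => _ cs _ _ _; apply: continuous_subspaceW cs.
  by move=> [x c] /= [/WU' Ux _].
- move=> _ [[x c] /= [/WU' Ux c1] <-].
  have [v [Vv -> hv]] := triv_section triv c Ux.
  exists x, v; split => //; apply: contra_eq_neq c1 => v0.
  by rewrite -hv v0 (triv0 triv Ux) normr0 eq_sym oner_eq0.
- move=> x v Wx Vv v0.
  have clx : closure W x by apply: subset_closure; exact: interior_subset.
  have Ux := WU' _ clx.
  have hv0 : h (inc E v) != 0.
    apply: contra_neq v0 => hv0; apply: (triv_inj triv Ux Vv (mem0v _)).
    by rewrite hv0 (triv0 triv Ux).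
  have n0 : `|h (inc E v)| != 0 by rewrite normr_eq0.
  exists `|h (inc E v)|^-1; first by rewrite invr_eq0.
  exists (x, `|h (inc E v)|^-1 *: h (inc E v)) => /=.
    by split => //; rewrite normrZ normfV normr_id mulVf.
  rewrite -(trivZ triv _ Ux Vv); case: triv => _ _ _ hs _.
  by apply: hs => //; exact: memvZ.
Qed.

Lemma compact_representatives : exists Q, representatives setT Q.
Proof.
have /choice[W /choice[Q WQ]] := local_representatives.
move: cptX; rewrite compact_cover => /(_ X setT W) [].
- by move=> x _; have [] := WQ x.
- by move=> x _; exists x => //; have [] := WQ x.
move=> D _ DW; exists (\bigcup_(i in [set` D]) Q i); split.
- rewrite bigcup_fset; apply: bigsetU_compact => i _.
  by have [_ _ []] := WQ i.
- by move=> e [i _]; have [_ _ [_ + _]] := WQ i; exact.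
- move=> x v _ Vv v0; have [i Di Wx] := DW x I.
  have [_ _ [_ _ /(_ x v Wx Vv v0)[c c0 Qc]]] := WQ i.
  by exists c => //; exists i.
Qed.
End CompactRepresentatives.

(** * Maximal growth along an invariant subbundle *)

Section Growth.
Variables (R : realType) (X : ptopologicalType) (E : vector_bundle R X).
Variables (g : riemannian_metric E) (T : homeo X) (A : aut E T).
Variables (V : forall x, {vspace fiber E x}).
Hypothesis subV : subbundle V.
Hypothesis invV : forall x, (aut_fib A x @: V x)%VS = V (T x).
Hypothesis V_neq0 : forall x, V x != 0%VS.
Hypothesis hausX : hausdorff_space X.
Hypothesis cptX : compact [set: X].

Local Notation nz := (nonzero_vectors V).
Local Notation An := (homeo_iter A).

Lemma nonzero_tnorm e : nz e -> 0 < tnorm g e.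
Proof. by move=> [x [v [_ v0 ->]]]; exact: fnorm_gt0. Qed.

Lemma nonzero_vectors_aut e : nz e -> nz (A e).
Proof.
move=> [x [v [Vv v0 ->]]]; exists (T x), (aut_fib A x v); split.
- by rewrite -invV memv_img.
- have [h h1 _] := aut_fib_bij A x.
  by apply: contra_neq v0 => e0; apply: (can_inj h1); rewrite e0 linear0.
- exact: autE.
Qed.

Lemma nonzero_vectors_aut_inv e : nz e -> nz (homeo_inv A e).
Proof.
move=> [y [w [wV w0 ->]]]; move: w wV w0.
move: (homeo_inv T y) (homeoVK T y) => x; case: _ / => w.
rewrite -invV => /memv_imgP[v Vv ->] w0.
rewrite -autE homeoK; exists x, v; split => //.
by apply: contra_neq w0 => ->; rewrite linear0.
Qed.

Lemma nonzero_vectors_iter n e : nz e -> nz (An n e).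
Proof.
move=> nze; case: n => n; rewrite /homeo_iter.
  by elim: n => //= n; exact: nonzero_vectors_aut.
by elim: n.+1 => //= m; exact: nonzero_vectors_aut_inv.
Qed.

Definition growth (n : int) (e : Defs.total E) : R :=
  ln (tnorm g (An n e)) - ln (tnorm g e).

Lemma growth_add m n e : growth (m + n) e = growth m e + growth n (An m e).
Proof. by rewrite /growth homeo_iter_add; ring. Qed.

Lemma growth_opp n e : growth (- n) (An n e) = - growth n e.
Proof. by rewrite /growth homeo_iterK opprB. Qed.

Lemma growth_scale n x (v : fiber E x) c : v \in V x -> v != 0 -> c != 0 ->
  growth n (inc E (c *: v)) = growth n (inc E v).
Proof.
move=> Vv v0 c0; rewrite /growth.
have [y [L LP]] := aut_iter_linear A n x.
have : 0 < tnorm g (inc E (L v)).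
  by rewrite -LP; apply: nonzero_tnorm; apply: nonzero_vectors_iter; exists x, v.
have := fnorm_gt0 g v0; rewrite !LP linearZ /= !fnormZ => h1 h2.
by rewrite !lnM ?posrE ?normr_gt0 //; ring.
Qed.

Lemma nonzero_at x : exists v : fiber E x, v \in V x /\ v != 0.
Proof. by have := V_neq0 x; rewrite -vpick0 => h; exists (vpick (V x)); rewrite memv_pick. Qed.

Lemma tnorm_iter_continuous n : continuous (fun e => tnorm g (An n e)).
Proof.
move=> e; apply: continuous_comp; first exact: homeo_iter_continuous.
exact: tnorm_continuous.
Qed.

(** The growth is invariant under scaling, hence determined on a compact set of
    representatives, where it is continuous. *)
Lemma growth_bounded n : exists C : R, forall e, nz e -> `|growth n e| <= C.
Proof.
have [Q [cQ Qnz QP]] := compact_representatives subV hausX cptX.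
have cgQ : compact (growth n @` Q).
  apply: continuous_compact => //; apply: continuous_in_subspaceT => e.
  move=> /set_mem /Qnz nze; rewrite /growth; apply: cvgB.
    apply: continuous_comp; first exact: tnorm_iter_continuous.
    by apply: continuous_ln; apply: nonzero_tnorm; exact: nonzero_vectors_iter.
  apply: continuous_comp; first exact: tnorm_continuous.
  by apply: continuous_ln; exact: nonzero_tnorm.
have [M [_ MP]] := compact_bounded cgQ.
exists (M + 1) => _ [x [v [Vv v0 ->]]].
have [c c0 Qc] := QP x v I Vv v0.
rewrite -(growth_scale n Vv v0 c0); apply: MP; first by rewrite ltrDl.
by exists (inc E (c *: v)).
Qed.

Lemma growth_linear_bound :
  exists C : R, forall n e, nz e -> `|growth n e| <= C * `|n|%N%:R.
Proof.
have [C1 C1P] := growth_bounded 1; have [C2 C2P] := growth_bounded (- 1%:Z).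
pose C := Num.max C1 C2.
have C1C e : nz e -> `|growth 1 e| <= C by move=> /C1P h; rewrite le_max h.
have C2C e : nz e -> `|growth (- 1%:Z) e| <= C by move=> /C2P h; rewrite le_max h orbT.
exists C => n e nze; elim/int_ind: n => [|n IH|n IH].
- by rewrite /growth subrr normr0 mulr0.
- have -> : n.+1%:Z = n%:Z + 1 by lia.
  rewrite growth_add; apply: le_trans (ler_normD _ _) _.
  have -> : absz (n%:Z + 1)%R = n.+1 by lia.
  rewrite -natr1 mulrDr mulr1 lerD //; apply: C1C; exact: nonzero_vectors_iter.
- have -> : - n.+1%:Z = - n%:Z + - 1%:Z by lia.
  rewrite growth_add; apply: le_trans (ler_normD _ _) _.
  have -> : absz (- n%:Z + - 1%:Z)%R = n.+1 by lia.
  rewrite abszN in IH.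
  rewrite -natr1 mulrDr mulr1 lerD //; apply: C2C; exact: nonzero_vectors_iter.
Qed.

Definition max_growth (n : int) (x : X) : R :=
  sup [set growth n e | e in [set e | nz e /\ Defs.proj e = x]].

Lemma max_growth_has_sup n x :
  has_sup [set growth n e | e in [set e | nz e /\ Defs.proj e = x]].
Proof.
split.
  have [v [Vv v0]] := nonzero_at x; exists (growth n (inc E v)), (inc E v) => //.
  by split; [exists x, v|exact: proj_inc].
have [C CP] := growth_bounded n.
by exists C => _ [e [nze _] <-]; apply: le_trans (ler_norm _) (CP _ nze).
Qed.

Lemma growth_le n e : nz e -> growth n e <= max_growth n (Defs.proj e).
Proof. by move=> nze; apply: ub_le_sup; [exact: (max_growth_has_sup n _).2|exists e]. Qed.

Lemma max_growth_le n x t : (forall e, nz e -> Defs.proj e = x -> growth n e <= t) ->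
  max_growth n x <= t.
Proof.
move=> h; apply: ge_sup; first exact: (max_growth_has_sup n x).1.
by move=> _ [e [nze ex] <-]; exact: h.
Qed.

Lemma max_growth_sub m n x :
  max_growth (m + n) x <= max_growth m x + max_growth n (homeo_iter T m x).
Proof.
apply: max_growth_le => e nze ex; rewrite growth_add lerD //.
  by rewrite -ex; exact: growth_le.
by rewrite -ex -(proj_aut_iter A); apply: growth_le; exact: nonzero_vectors_iter.
Qed.

Lemma max_growth_bound :
  exists C : R, forall n x, `|max_growth n x| <= C * `|n|%N%:R.
Proof.
have [C CP] := growth_linear_bound; exists C => n x; rewrite ler_norml; apply/andP; split.
  have [v [Vv v0]] := nonzero_at x.
  have nzv : nz (inc E v) by exists x, v.
  have := growth_le n nzv; rewrite proj_inc; apply: le_trans.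
  by have := CP n _ nzv; rewrite ler_norml => /andP[].
apply: max_growth_le => e nze _.
exact: le_trans (ler_norm _) (CP _ _ nze).
Qed.

Lemma growth_geE n e s : nz e ->
  (s <= growth n e) = (expR s * tnorm g e <= tnorm g (An n e)).
Proof.
move=> nze; have h1 := nonzero_tnorm nze.
have h2 := nonzero_tnorm (nonzero_vectors_iter n nze).
rewrite /growth lerBrDr -[in RHS](lnK h2) -[X in _ * X <= _](lnK h1).
by rewrite -expRD ler_expR.
Qed.

(** Up to scaling, the vectors that grow by at least [s] form a compact set,
    whose projection to the base is closed. *)
Lemma max_growth_upper_semicontinuous n : upper_semicontinuous (max_growth n).
Proof.
move=> t; have [Q [cQ Qnz QP]] := compact_representatives subV hausX cptX.
rewrite (_ : [set x | _] = \bigcap_(s in [set s | s < t])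
   (@Defs.proj R X E) @` (Q `&` [set e | 0 <= tnorm g (An n e) - expR s * tnorm g e])).
  apply: closed_bigI => s _; apply: compact_closed => //.
  apply: continuous_compact.
    by apply: continuous_subspaceT; exact: Defs.proj_continuous.
  apply: compact_closedI => //.
  rewrite (_ : [set e | _] =
    (fun e => tnorm g (An n e) - expR s * tnorm g e) @^-1` [set z | 0 <= z]) //.
  apply: preimage_closed; last exact: closed_ge.
  move=> e _; apply: cvgB; first exact: tnorm_iter_continuous.
  by apply: cvgM; [exact: cvg_cst|exact: tnorm_continuous].
apply/seteqP; split => x.
  move=> /= tx s /= st.
  have [_ [e [nze ex] <-] se] := sup_gt (max_growth_has_sup n x).1 (lt_le_trans st tx).
  have [v [Vv v0 ev]] := nonzero_vectors_at nze ex.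
  have [c c0 Qc] := QP x v I Vv v0; exists (inc E (c *: v)); last exact: proj_inc.
  split => //=; rewrite subr_ge0 -growth_geE; last exact: Qnz.
  by rewrite growth_scale // -ev ltW.
move=> h /=; apply/ler_addgt0Pr => e e0.
have [w [Qw hw] wx] : ((@Defs.proj R X E) @`
    (Q `&` [set e' | 0 <= tnorm g (An n e') - expR (t - e) * tnorm g e'])) x.
  by apply: h => /=; rewrite ltrBlDr ltrDl.
move: hw; rewrite /= subr_ge0 -growth_geE; last exact: Qnz.
by have := growth_le n (Qnz _ Qw); rewrite wx; lra.
Qed.

Lemma sup_expR (S : set R) : has_sup S -> sup (expR @` S) = expR (sup S).
Proof.
move=> [S0 Sb]; apply/eqP; rewrite eq_le; apply/andP; split.
  apply: ge_sup; first by have [s Ss] := S0; exists (expR s), s.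
  by move=> _ [s Ss <-]; rewrite ler_expR; exact: ub_le_sup.
have ubE s : S s -> expR s <= sup (expR @` S).
  move=> Ss; apply: ub_le_sup; last by exists s.
  have [M MP] := Sb; exists (expR M) => _ [s' Ss' <-]; rewrite ler_expR; exact: MP.
have pos : 0 < sup (expR @` S).
  by have [s Ss] := S0; apply: lt_le_trans (ubE s Ss); exact: expR_gt0.
rewrite -[leRHS](lnK pos) ler_expR; apply: ge_sup => // s Ss.
by rewrite -ler_expR (lnK pos); exact: ubE.
Qed.

Lemma opnorm_max_growth n x y (L : 'Hom(fiber E x, fiber E y)) :
  (forall v, v \in V x -> An n (inc E v) = inc E (L v)) ->
  opnorm g (V x) L = expR (max_growth n x).
Proof.
move=> LP; rewrite /max_growth -sup_expR; last exact: max_growth_has_sup.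
congr sup; apply/seteqP; split => z.
  move=> [v [Vv v1] <-].
  have v0 : v != 0 by apply: contra_eq_neq v1 => ->; rewrite /fnorm fnorm0 eq_sym oner_eq0.
  exists (growth n (inc E v)).
    by exists (inc E v) => //; split; [exists x, v|exact: proj_inc].
  rewrite /growth -/(fnorm g v) v1 ln1 subr0 LP //.
  by rewrite lnK // -LP //; apply: nonzero_tnorm; apply: nonzero_vectors_iter; exists x, v.
move=> [_ [e [nze ex] <-] <-].
have [v [Vv v0 ->]] := nonzero_vectors_at nze ex.
have fv := fnorm_gt0 g v0.
pose c := (tnorm g (inc E v))^-1.
have c0 : c != 0 by rewrite invr_eq0 gt_eqF.
have cv1 : tnorm g (inc E (c *: v)) = 1.
  by rewrite fnormZ /c normfV ger0_norm ?(ltW fv) // mulVf // gt_eqF.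
exists (c *: v); first by split => //; exact: memvZ.
rewrite -(growth_scale n Vv v0 c0) /growth cv1 ln1 subr0 LP; last exact: memvZ.
rewrite lnK // -LP; last exact: memvZ.
apply: nonzero_tnorm; apply: nonzero_vectors_iter; exists x, (c *: v).
by split => //; [exact: memvZ|rewrite scaler_eq0 negb_or c0].
Qed.

Lemma aut_pow_img n x : (aut_pow A n x @: V x)%VS = V (iter n T x).
Proof.
elim: n => [|n IH] /=; first by rewrite lim1g.
by rewrite limg_comp IH invV.
Qed.

Lemma aut_pow_inj n x : lker (aut_pow A n x) == 0%VS.
Proof.
apply/lker0P; elim: n => [|n IH] v w /=; first by rewrite !id_lfunE.
rewrite !comp_lfunE => h; apply: IH; have [k h1 _] := aut_fib_bij A (iter n T x).
exact: (can_inj h1).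
Qed.

(** The inverse of the [n]-th iterate over [x] is the [(-n)]-th iterate over
    [T^n x]. *)
Lemma qc_distortionE n x :
  qc_distortion g (V x) (aut_pow A n x) = distortion T max_growth n x.
Proof.
rewrite /qc_distortion aut_pow_img (@opnorm_max_growth n%:Z); last first.
  by move=> v _; exact: aut_iter_pos.
rewrite (@opnorm_max_growth (- n%:Z)); last first.
  move=> w; rewrite -aut_pow_img => /memv_imgP[v Vv ->].
  by rewrite (lker0_lfunK (aut_pow_inj n x)); exact: aut_iter_neg.
by rewrite -expRD expRK.
Qed.
End Growth.

(** * Exponents of vectors and of the maximal growth *)

Lemma le_mx_norm (R : realType) n (c : 'rV[R]_n) i : `|c 0 i| <= `|c|.
Proof.
rewrite [leRHS]/Num.norm /= mx_normrE.
exact: (@le_bigmax _ _ _ 0 (fun ij : 'I_1 * 'I_n => `|c ij.1 ij.2|) (0, i)).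
Qed.

Lemma triv_sum (R : realType) (X : topologicalType) (E : vector_bundle R X)
    (V : forall x, {vspace fiber E x}) r (U : set X) h s
    (triv : trivialization (@inc R X E) V (r := r) U h s) x n
    (c : 'I_n -> R) (b : 'I_n -> fiber E x) : U x -> (forall i, b i \in V x) ->
  h (inc E (\sum_i c i *: b i)) = \sum_i c i *: h (inc E (b i)).
Proof.
move=> Ux Vb; elim: (index_enum _) => [|i l IH]; first by rewrite !big_nil (triv0 triv).
rewrite !big_cons (trivD triv) ?IH //.
by apply: memv_suml => j _; apply: memvZ.
Qed.

Lemma near_dist (R : realType) (u : nat -> R) (l e : R) : u @ \oo --> l ->
  0 < e -> \forall n \near \oo, `|l - u n| <= e.
Proof. by move=> /cvgrPdist_le; exact. Qed.

Lemma near_norm0 (R : realType) (u : nat -> R) (e : R) : u @ \oo --> (0 : R) ->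
  0 < e -> \forall n \near \oo, `|u n| <= e.
Proof. by move=> /cvgr0Pnorm_le; exact. Qed.

Lemma squeeze_subexp (R : realType) (u w : nat -> R) (l : R) :
  (forall n, u n <= w n) ->
  (forall eps, 0 < eps -> exists c, 0 < c /\ forall n, w n <= u n + (c + eps * n%:R)) ->
  w n / n%:R @[n --> \oo] --> l -> u n / n%:R @[n --> \oo] --> l.
Proof.
move=> uw wu wl; apply/cvgrPdist_le => e e0.
have [c [c0 hc]] := wu (e / 4) (divr_gt0 e0 (ltr0Sn _ 3)).
have e4 : 0 < e / 4 by lra.
have evw := near_dist wl e4.
have evc := near_norm0 (@cvg_nat_inv R c) e4.
near=> n.
have h1 : `|l - w n / n%:R| <= e / 4 by near: n.
have h2 : c / n%:R <= e / 4 by apply: le_trans (ler_norm _) _; near: n.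
have n0 : 0 < n%:R :> R by rewrite ltr0n; near: n; exists 1%N.
have h3 : u n / n%:R <= w n / n%:R by rewrite ler_pM2r ?invr_gt0.
have h4 : w n / n%:R <= u n / n%:R + c / n%:R + e / 4.
  rewrite -mulrDl -[X in _ + X](mulfK (lt0r_neq0 n0)) -mulrDl ler_pM2r ?invr_gt0 //.
  by rewrite -addrA.
move: h1; rewrite !ler_norml; lra.
Unshelve. all: by end_near.
Qed.

Section Exponents.
Variables (R : realType) (X : ptopologicalType) (E : vector_bundle R X).
Variables (g : riemannian_metric E) (T : homeo X) (A : aut E T).
Variables (V : forall x, {vspace fiber E x}).
Hypothesis subV : subbundle V.
Hypothesis invV : forall x, (aut_fib A x @: V x)%VS = V (T x).
Hypothesis V_neq0 : forall x, V x != 0%VS.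
Hypothesis hausX : hausdorff_space X.
Hypothesis cptX : compact [set: X].

(** The coordinates of a vector in the basis [b] read in a trivialization are
    bounded by a multiple of its norm, by compactness of the unit sphere; so no
    vector grows much more than all the [b i] do. *)
Lemma max_growth_basis x : exists r (b : 'I_r -> fiber E x) (K : R),
  (forall i, b i \in V x /\ b i != 0) /\
  forall n t, (forall i, growth g A n (inc E (b i)) <= t) ->
    max_growth g A V n x <= K + t.
Proof.
have [r /(_ x)[U [h [s [oU Ux triv]]]]] := subV.
have /choice[b bP] := fun i : 'I_r => triv_section triv (delta_mx 0 i) Ux.
have Vb i : b i \in V x by have [] := bP i.
have hb i : h (inc E (b i)) = delta_mx 0 i by have [] := bP i.
have b0 i : b i != 0.
  apply/eqP => bi0; have := hb i; rewrite bi0 (triv0 triv) // => /matrixP /(_ 0 i).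
  by rewrite !mxE !eqxx => /eqP; rewrite eq_sym oner_eq0.
have Sphere0 c : `|c| = 1 -> nonzero_vectors V (s (x, c)).
  move=> c1; have [v [Vv -> hv]] := triv_section triv c Ux.
  exists x, v; split => //; apply: contra_eq_neq c1 => v0.
  by rewrite -hv v0 (triv0 triv Ux) normr0 eq_sym oner_eq0.
pose Q := s @` ([set x] `*` [set c : 'rV[R]_r | `|c| = 1]).
have cQ : compact Q.
  apply: continuous_compact; last first.
    by apply: compact_setX; [exact: compact_set1|exact: sphere_compact].
  case: triv => _ cs _ _ _; apply: continuous_subspaceW cs.
  by move=> [y c] /= [-> _].
have clQ : compact ((fun e => ln (tnorm g e)) @` Q).
  apply: continuous_compact => //; apply: continuous_in_subspaceT => e.
  move=> /set_mem [[y c] /= [-> c1] <-].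
  apply: continuous_comp; first exact: tnorm_continuous.
  by apply: continuous_ln; apply: nonzero_tnorm (Sphere0 _ c1).
have [M0 [_ M0P]] := compact_bounded clQ.
pose M := M0 + 1.
have MP c : `|c| = 1 -> expR (- M) <= tnorm g (s (x, c)).
  move=> c1; rewrite -[leRHS]lnK; last exact: nonzero_tnorm (Sphere0 _ c1).
  rewrite ler_expR; have : `|ln (tnorm g (s (x, c)))| <= M.
    by apply: M0P; [rewrite ltrDl|exists (s (x, c)) => //; exists (x, c)].
  by rewrite ler_norml => /andP[].
have coord v : v \in V x -> v != 0 -> `|h (inc E v)| <= expR M * tnorm g (inc E v).
  move=> Vv v0; set c := h (inc E v).
  have c0 : `|c| != 0.
    rewrite normr_eq0; apply: contra_neq v0 => c0.
    by apply: (triv_inj triv Ux Vv (mem0v _)); rewrite -/c c0 (triv0 triv).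
  have c1 : `| (`|c|^-1) *: c | = 1 by rewrite normrZ normfV normr_id mulVf.
  have := MP _ c1; rewrite /c -(trivZ triv _ Ux Vv) -/c.
  case: triv => _ _ _ hs _; rewrite hs ?memvZ // fnormZ normfV normr_id.
  have cpos : 0 < `|c| by rewrite lt_def c0 normr_ge0.
  rewrite expRN -ler_pdivrMl ?invr_gt0 // invrK => hh.
  rewrite -ler_pdivrMl ?expR_gt0 //; move: hh; rewrite mulrC.
  by [].
pose K0 := 2 ^+ r * (expR M * \sum_i tnorm g (inc E (b i))) + 1.
have K1 : 0 <= expR M * \sum_i tnorm g (inc E (b i)).
  by rewrite mulr_ge0 ?expR_ge0 // sumr_ge0 // => i _; exact: tnorm_ge0.
have K0pos : 0 < K0 by rewrite ltr_wpDl // mulr_ge0 // exprn_ge0.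
exists r, b, (ln K0); split => // n t bt.
apply: max_growth_le => // e nze ex.
have [v [Vv v0 ->]] := nonzero_vectors_at nze ex.
have [y [L LP]] := aut_iter_linear A n x.
have pos w : w \in V x -> w != 0 -> 0 < tnorm g (inc E (L w)).
  move=> Vw w0; rewrite -LP; apply: (@nonzero_tnorm _ _ _ _ V).
  by apply: nonzero_vectors_iter => //; exists x, w.
have fv := fnorm_gt0 g v0.
have vE : v = \sum_i h (inc E v) 0 i *: b i.
  apply: (triv_inj triv Ux Vv).
    by apply: memv_suml => j _; apply: memvZ.
  rewrite (triv_sum triv) // [LHS]row_sum_delta.
  by apply: eq_bigr => i _; rewrite hb.
have Lb i : tnorm g (inc E (L (b i))) <= expR t * tnorm g (inc E (b i)).
  have := bt i; rewrite /growth LP => hi.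
  rewrite -[leLHS](lnK (pos _ (Vb i) (b0 i))) -[X in _ * X](lnK (fnorm_gt0 g (b0 i))).
  by rewrite -expRD ler_expR; lra.
have bound : tnorm g (inc E (L v)) <= expR t * tnorm g (inc E v) * K0.
  rewrite {1}vE linear_sum /=; apply: le_trans (fnorm_sum _ _) _.
  rewrite /K0 mulrDr mulr1 -[leLHS]addr0 lerD //; last by rewrite mulr_ge0 ?expR_ge0 ?ltW.
  rewrite mulrCA ler_pM2l ?exprn_gt0 // mulrA mulr_sumr; apply: ler_sum => i _.
  rewrite linearZ /= fnormZ.
  apply: (@le_trans _ _ ((expR M * tnorm g (inc E v)) * (expR t * tnorm g (inc E (b i))))).
    apply: ler_pM => //; [exact: tnorm_ge0|].
    exact: le_trans (le_mx_norm _ _) (coord _ Vv v0).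
  by rewrite le_eqVlt; apply/orP; left; apply/eqP; ring.
rewrite /growth LP lerBlDr -ler_expR (lnK (pos _ Vv v0)) !expRD (lnK K0pos) (lnK fv).
by apply: le_trans bound _; rewrite le_eqVlt; apply/orP; left; apply/eqP; ring.
Qed.

(** Pointwise exponents become an exponent of the operator norm because finitely
    many vectors control it. This is used with [nu n] equal to [n] and to [- n]. *)
Lemma max_growth_limit (nu : nat -> int) x (l : R) :
  (forall v : fiber E x, v \in V x -> v != 0 ->
    growth g A (nu n) (inc E v) / n%:R @[n --> \oo] --> l) ->
  max_growth g A V (nu n) x / n%:R @[n --> \oo] --> l.
Proof.
move=> vl; have [r [b [K [bP bK]]]] := max_growth_basis x.
have [v [Vv v0]] := nonzero_at V_neq0 x.
apply/cvgrPdist_le => e e0; have e2 : 0 < e / 2 by lra.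
have evb : \forall n \near \oo, forall i,
    growth g A (nu n) (inc E (b i)) / n%:R <= l + e / 2.
  apply: filter_forall => i; have [Vb b0] := bP i.
  have := near_dist (vl _ Vb b0) e2; apply: filterS => n.
  rewrite ler_norml; lra.
have evv := near_dist (vl _ Vv v0) e0.
have evK := near_norm0 (@cvg_nat_inv R K) e2.
near=> n.
have n0 : 0 < n%:R :> R by rewrite ltr0n; near: n; exists 1%N.
have h1 : max_growth g A V (nu n) x <= K + (l + e / 2) * n%:R.
  apply: bK => i; rewrite -ler_pdivrMr //; move: i; near: n; exact: evb.
have h2 : K / n%:R <= e / 2 by apply: le_trans (ler_norm _) _; near: n.
have h3 : `|l - growth g A (nu n) (inc E v) / n%:R| <= e by near: n.
have h4 : growth g A (nu n) (inc E v) / n%:R <= max_growth g A V (nu n) x / n%:R.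
  rewrite ler_pM2r ?invr_gt0 //.
  have nzv : nonzero_vectors V (inc E v) by exists x, v.
  have := growth_le g subV invV V_neq0 hausX cptX (nu n) nzv.
  by rewrite proj_inc.
have h5 : max_growth g A V (nu n) x / n%:R <= K / n%:R + (l + e / 2).
  by rewrite -[X in _ + X](mulfK (lt0r_neq0 n0)) -mulrDl ler_pM2r ?invr_gt0.
move: h3; rewrite !ler_norml; lra.
Unshelve. all: by end_near.
Qed.

(** The growth of a vector over [x] lies between [max_growth n x] minus the
    distortion and [max_growth n x]. *)
Lemma growth_limit x (v : fiber E x) (l : R) :
  (forall eps, 0 < eps -> exists c : R, 0 < c /\
    forall x n, distortion T (max_growth g A V) n x <= c + eps * n%:R) ->
  v \in V x -> v != 0 ->
  max_growth g A V n%:Z x / n%:R @[n --> \oo] --> l ->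
  max_growth g A V (- n%:Z) x / n%:R @[n --> \oo] --> - l ->
  growth g A n%:Z (inc E v) / n%:R @[n --> \oo] --> l /\
  growth g A (- n%:Z) (inc E v) / n%:R @[n --> \oo] --> - l.
Proof.
move=> unif Vv v0 lp lm.
have nzv : nonzero_vectors V (inc E v) by exists x, v.
have gle n w : nonzero_vectors V w ->
    growth g A n w <= max_growth g A V n (Defs.proj w).
  exact: growth_le.
have gx n : growth g A n (inc E v) <= max_growth g A V n x.
  by have := gle n _ nzv; rewrite proj_inc.
have gop n : - growth g A n (inc E v) <= max_growth g A V (- n) (homeo_iter T n x).
  have := gle (- n) _ (nonzero_vectors_iter invV n nzv).
  by rewrite growth_opp proj_aut_iter proj_inc.
split.
  apply: (squeeze_subexp (w := fun n => max_growth g A V n%:Z x)) lp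
    => [n|eps eps0]; first exact: gx.
  have [c [c0 cP]] := unif eps eps0; exists c; split => // n.
  have := cP x n; have := gop n%:Z; rewrite /distortion /=; lra.
apply: (squeeze_subexp (w := fun n => max_growth g A V (- n%:Z) x)) lm
  => [n|eps eps0]; first exact: gx.
have [c [c0 cP]] := unif eps eps0; exists c; split => // n.
have := cP (iter n (homeo_inv T) x) n; have := gop (- n%:Z).
rewrite /distortion opprK iter_SK homeo_iterN; lra.
Qed.
End Exponents.

(** * Dominated splittings *)

Lemma ae_forall_ord d (X : measurableType d) (R : realType) (mu : probability X R)
  k (P : 'I_k -> X -> Prop) : (forall i, {ae mu, forall x, P i x}) ->
  {ae mu, forall x, forall i, P i x}.
Proof. by move=> aeP; apply: filter_forall. Qed.

Lemma cvg_mean_shift (R : realType) (t : nat -> R) (c l : R) :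
  n%:R^-1 * t n @[n --> \oo] --> l <-> (t n - c) / n%:R @[n --> \oo] --> l.
Proof.
have e n : (t n - c) / n%:R = n%:R^-1 * t n - c / n%:R by rewrite mulrBl mulrC.
under [X in _ <-> (X @ _ --> _)]eq_fun do rewrite e.
split=> h; first by rewrite -[l]subr0; apply: cvgB h _; exact: cvg_nat_inv.
have := cvgD h (@cvg_nat_inv R c); rewrite addr0.
move=> H; rewrite (_ : (fun n => n%:R^-1 * t n) =
    (fun n => n%:R^-1 * t n - c / n%:R) \+ (fun n => c / n%:R)).
  exact: H.
by apply/funext => n /=; rewrite subrK.
Qed.

Section Main.
Variables (R : realType) (X : ptopologicalType).
Hypothesis hausX : hausdorff_space X.
Hypothesis cptX : compact [set: X].
Variables (T : homeo X) (E : vector_bundle R X) (g : riemannian_metric E).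
Variables (A : aut E T) (k : nat) (V : 'I_k -> forall x, {vspace fiber E x}).
Hypothesis domV : dominated_splitting g A V.

Lemma dominated_subbundle i : subbundle (V i).
Proof. by case: domV => -[h _ _] _ _. Qed.

Lemma dominated_neq0 i x : V i x != 0%VS.
Proof. by case: domV => -[_ h _] _ _. Qed.

Lemma dominated_invariant i x : (aut_fib A x @: V i x)%VS = V i (T x).
Proof. by case: domV => _ h _. Qed.

Let a i := max_growth g A (V i).

Lemma dominated_max_growth_sub i m n x :
  a i (m + n) x <= a i m x + a i n (homeo_iter T m x).
Proof.
exact: (max_growth_sub g (dominated_subbundle i) (dominated_invariant i)
  (dominated_neq0 i) hausX cptX).
Qed.

Lemma dominated_max_growth_bound i :
  exists C : R, forall n x, `|a i n x| <= C * `|n|%N%:R.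
Proof.
exact: (max_growth_bound g (dominated_subbundle i) (dominated_invariant i)
  (dominated_neq0 i) hausX cptX).
Qed.

Lemma dominated_max_growth_usc i n : upper_semicontinuous (a i n).
Proof.
exact: (@max_growth_upper_semicontinuous _ _ _ g _ _ _ (dominated_subbundle i)
  (dominated_invariant i) (dominated_neq0 i) hausX cptX n).
Qed.

Lemma dominated_qc_distortionE i n x :
  qc_distortion g (V i x) (aut_pow A n x) = distortion T (a i) n x.
Proof.
exact: (qc_distortionE g (dominated_subbundle i) (dominated_invariant i)
  (dominated_neq0 i) hausX cptX).
Qed.

Lemma regular_of_oseledets i x : oseledets_coincides g A V x -> regular (a i) x.
Proof.
move=> [W [lam [[_ _ _ lim] WV]]]; rewrite /a; exists (lam i); split.
  apply: (@max_growth_limit R X E g T A (V i) (dominated_subbundle i)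
    (dominated_invariant i) (dominated_neq0 i) hausX cptX (fun n => n%:Z)) => v Vv v0.
  have Wv : v \in W i by rewrite WV.
  by apply/cvg_mean_shift; have [] := lim i v Wv v0.
apply: (@max_growth_limit R X E g T A (V i) (dominated_subbundle i)
    (dominated_invariant i) (dominated_neq0 i) hausX cptX (fun n => - n%:Z)) => v Vv v0.
apply/cvg_mean_shift; apply/cvgNP; rewrite opprK.
have Wv : v \in W i by rewrite WV.
have [_ h] := lim i v Wv v0.
apply: cvg_trans h; apply: near_eq_cvg; apply: nearW => n.
by rewrite mulrNz invrN mulNr.
Qed.

Lemma quasiconformal_of_oseledets i :
  (forall mu : probability (borel X) R, invariant_measure T mu ->
     {ae mu, forall x : borel X, oseledets_coincides g A V x}) ->
  unif_subexp_quasiconformal g A (V i).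
Proof.
move=> ose eps eps0; have [C CP] := dominated_max_growth_bound i.
have [|c [c0 cP]] := uniform_distortion_of_regular
  (dominated_max_growth_sub i) CP (@dominated_max_growth_usc i) hausX cptX _ eps0.
  move=> mu inv; apply: ae_imply (ose mu inv) => x; exact: regular_of_oseledets.
by exists c; split => // x n; rewrite dominated_qc_distortionE.
Qed.

Lemma unit_vectors x : exists v : 'I_k -> fiber E x,
  forall i, v i \in V i x /\ fnorm g (v i) = 1.
Proof.
have /choice[v vP] : forall i, exists v : fiber E x, v \in V i x /\ fnorm g v = 1.
  move=> i; have [v [Vv v0]] := nonzero_at (dominated_neq0 i) x.
  have fv := fnorm_gt0 g v0.
  exists ((fnorm g v)^-1 *: v); split; first exact: memvZ.
  by rewrite /fnorm fnormZ normfV ger0_norm ?ltW // mulVf // gt_eqF.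
by exists v.
Qed.

(** Domination makes the difference of consecutive exponents at least [ln tau]. *)
Lemma exponents_decreasing x (lam : 'I_k -> R) :
  (forall i (v : fiber E x), v \in V i x -> v != 0 ->
     growth g A n%:Z (inc E v) / n%:R @[n --> \oo] --> lam i) ->
  forall i j : 'I_k, (i < j)%N -> lam j < lam i.
Proof.
move=> lim.
have step (i j : 'I_k) : j = i.+1 :> nat -> lam j < lam i.
  move=> ij; case: domV => _ _ [c [tau [c0 tau1 dom]]].
  have [v vP] := unit_vectors x.
  have v0 i' : v i' != 0.
    have [_ v1] := vP i'; apply: contra_eq_neq v1 => ->.
    by rewrite /fnorm fnorm0 eq_sym oner_eq0.
  have lim_diff : growth g A n%:Z (inc E (v i)) / n%:R -
      growth g A n%:Z (inc E (v j)) / n%:R @[n --> \oo] --> lam i - lam j.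
    exact: cvgB (lim i _ (vP i).1 (v0 i)) (lim j _ (vP j).1 (v0 j)).
  have lntau : 0 < ln tau by rewrite ln_gt0.
  suff : ln tau <= lam i - lam j by lra.
  have lim_tau : ln c / n%:R + ln tau @[n --> \oo] --> ln tau.
    by rewrite -[X in _ --> X]add0r; apply: cvgD; [exact: cvg_nat_inv|exact: cvg_cst].
  apply: (ler_cvg_to lim_tau lim_diff).
  near=> n; have n0 : 0 < n%:R :> R by rewrite ltr0n; near: n; exists 1%N.
  have tpos i' : 0 < fnorm g (aut_pow A n x (v i')).
    rewrite /fnorm -aut_iter_pos; apply: (@nonzero_tnorm _ _ _ _ (V i')).
    apply: (nonzero_vectors_iter (dominated_invariant i')).
    by exists x, (v i'); split => //; exact: (vP i').1.
  have grE i' : growth g A n%:Z (inc E (v i')) = ln (fnorm g (aut_pow A n x (v i'))).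
    rewrite /growth -/(fnorm g (v i')) (vP i').2 ln1 subr0.
    by rewrite -[homeo_iter A n _]/(aut_iter A n (v i')) aut_iter_pos.
  have := dom x v vP i j ij n; rewrite !grE /=.
  rewrite -mulrBl -(ln_div (tpos i) (tpos j)) => d.
  have tn : 0 < tau ^+ n by rewrite exprn_gt0 // (lt_trans ltr01).
  rewrite ler_pdivlMr // mulrDl divfK ?lt0r_neq0 // mulr_natr -lnXn ?(lt_trans ltr01) //.
  rewrite -lnM ?posrE // ler_ln ?posrE ?mulr_gt0 ?invr_gt0 ?tpos //; exact: ltW d.
have far d : forall i j : 'I_k, (j = i + d.+1 :> nat)%N -> lam j < lam i.
  elim: d => [|d IH] i j ij; first by apply: step; rewrite ij addn1.
  have lt : (i + d.+1 < k)%N by apply: ltn_trans (ltn_ord j); rewrite ij ltn_add2l.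
  apply: lt_trans (IH i (Ordinal lt) erefl); apply: step => /=.
  by rewrite ij addnS.
move=> i j ij; apply: (far (j - i).-1); rewrite prednK ?subn_gt0 // subnKC //.
exact: ltnW.
Unshelve. all: by end_near.
Qed.

Lemma oseledets_of_quasiconformal (mu : probability (borel X) R) :
  (forall i, unif_subexp_quasiconformal g A (V i)) -> invariant_measure T mu ->
  {ae mu, forall x : borel X, oseledets_coincides g A V x}.
Proof.
move=> unif inv.
have unif' i eps : 0 < eps -> exists c : R, 0 < c /\
    forall x n, distortion T (a i) n x <= c + eps * n%:R.
  move=> /(unif i)[c [c0 cP]]; exists c; split => // x n.
  by rewrite -dominated_qc_distortionE; exact: cP.
have reg i : {ae mu, forall x : borel X, regular (a i) x}.
  have [C CP] := dominated_max_growth_bound i.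
  exact: (regular_of_uniform_distortion (dominated_max_growth_sub i) CP
    (@dominated_max_growth_usc i) (unif' i) inv).
apply: ae_imply (ae_forall_ord reg) => x /choice[lam lamP].
have lim i v : v \in V i x -> v != 0 ->
    growth g A n%:Z (inc E v) / n%:R @[n --> \oo] --> lam i /\
    growth g A (- n%:Z) (inc E v) / n%:R @[n --> \oo] --> - lam i.
  move=> Vv v0; have [h1 h2] := lamP i.
  exact: (growth_limit (dominated_subbundle i) (dominated_invariant i)
    (dominated_neq0 i) hausX cptX (unif' i) Vv v0 h1 h2).
exists (fun i => V i x), lam; split => //.
have [[_ _ dir] _ _] := domV.
split.
- by move=> j; exact: dominated_neq0.
- exact: dir.
- by apply: exponents_decreasing => i v Vv v0; have [] := lim i v Vv v0.
- move=> j v Vv v0; have [h1 h2] := lim j v Vv v0; split.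
    by apply/(cvg_mean_shift _ (ln (tnorm g (inc E v)))).
  have : n%:R^-1 * ln (tnorm g (aut_iter A (- n%:Z) v)) @[n --> \oo] --> - lam j.
    by apply/(cvg_mean_shift _ (ln (tnorm g (inc E v)))).
  move=> /cvgN; rewrite opprK; apply: cvg_trans; apply: near_eq_cvg; apply: nearW => n.
  by rewrite mulrNz invrN mulNr.
Qed.
End Main.

Theorem proposition1p2 (R : realType) (X : ptopologicalType)
  (hausX : hausdorff_space X) (cptX : compact [set: X])
  (fdX : finite_dimensional R X)
  (T : homeo X) (minT : minimal T)
  (E : vector_bundle R X) (g : riemannian_metric E) :
  oseledets_is_finest_dominated g T =
  [set A : aut E T |
    exists (k : nat) (V : 'I_k -> forall x, {vspace fiber E x}),
      finest_dominated_splitting g A V /\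
      forall i : 'I_k, unif_subexp_quasiconformal g A (V i)].
Proof.
apply/seteqP; split=> A [k [V [finV hV]]]; exists k, V; split => //.
  by move=> i; apply: quasiconformal_of_oseledets hV => //; exact: finV.1.
by move=> mu; apply: oseledets_of_quasiconformal hV => //; exact: finV.1.
Qed.
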